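(* Let $n\ge 1$, $p>1$, $T>0$, $a\in\mathbb{R}^n$. Suppose that $u$ is a smooth solution of $$u_t=\Delta u+|u|^{p-1}u\quad\text{in }\mathbb{R}^n\times(0,T)$$ which is self-similar about $(a,T)$, satisfies $u_t(x,0)>0$ for all $x\in\mathbb{R}^n$, and suppose that one of the following conditions holds: (1) $\displaystyle\int_{\mathbb{R}^n}|u(x,t)|^{2p}(T-t)^{\frac{2p}{p-1}}e^{-\frac{|x-a|^2}{4(T-t)}}\,dx<\infty$ for all $t\in(0,T)$; (2) $p>1+\sqrt{\tfrac43}$. Then $u(x,t)=\kappa\,(T-t)^{-\frac1{p-1}}$ for all $(x,t)\in\mathbb{R}^n\times(0,T)$, where $\kappa:=\left(\tfrac1{p-1}\right)^{\frac1{p-1}}$.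
   Context: Solutions are real-valued. A smooth solution $u$ on $\mathbb{R}^n\times(0,T)$ is called self-similar about $(a,T)$ if $u(x,t)=\lambda^{\frac{2}{p-1}}u\big(a+\lambda(x-a),\,T+\lambda^2(t-T)\big)$ for every $\lambda>0$ (whenever both times $t$ and $T+\lambda^2(t-T)$ lie in $(0,T)$). Equivalently, there is a function $w$ on $\mathbb{R}^n$ with $u(x,t)=(T-t)^{-\frac1{p-1}}w\big(\tfrac{x-a}{\sqrt{T-t}}\big)$. Such a $u$ extends smoothly to $t=0$ by this formula, and $u_t(x,0)$ refers to this extension. *)

(* Defs.v *)
From HB Require Import structures.
From mathcomp Require Import all_boot all_order all_algebra.
From mathcomp Require Import all_classical all_reals all_analysis.
Import Order.TTheory GRing.Theory Num.Theory.
Import numFieldNormedType.Exports.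

Set Implicit Arguments.
Unset Strict Implicit.
Unset Printing Implicit Defensive.

Local Open Scope classical_set_scope.
Local Open Scope ring_scope.

Section smooth.
Context {R : realType} {V : normedModType R}.

(* Meant for A open and V finite dimensional, where continuity of all
   directional derivatives up to order k is the usual notion of class C^k. *)
Fixpoint Ck_on (k : nat) (A : set V) (f : V -> R) : Prop :=
  if k is k'.+1 then
    {in A, continuous f} /\
    forall v : V, {in A, forall z, derivable f z v} /\
                  Ck_on k' A (fun z => 'D_v f z)
  else {in A, continuous f}.

Definition smooth_on (A : set V) (f : V -> R) : Prop :=
  forall k, Ck_on k A f.

End smooth.

Section euclidean.
Context {R : realType} {n : nat}.

(* The library norm on 'rV[R]_n is the sup norm, hence this definition. *)
Definition sqnorm2 (x : 'rV[R]_n) : R := \sum_(i < n) x 0 i ^+ 2.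

Definition laplacian (f : 'rV[R]_n -> R) (x : 'rV[R]_n) : R :=
  \sum_(i < n) 'D_(delta_mx 0 i) (fun y => 'D_(delta_mx 0 i) f y) x.

End euclidean.

Section with_sigma_finite.
Context d (T : measurableType d) (R : realType) (m : {measure set T -> \bar R}).
Hypothesis sm : sigma_finite [set: T] m.

Let with_sf : set T -> \bar R := let _ := sm in m.
HB.instance Definition _ := Measure.copy with_sf m.
HB.instance Definition _ := Measure_isSigmaFinite.Build _ _ _ with_sf sm.
Definition with_sigma_finite : {sigma_finite_measure set T -> \bar R} := with_sf.

End with_sigma_finite.

Section lebesgue.
Context {R : realType}.
Local Open Scope ereal_scope.

Definition tcons n (z : measurableTypeR R * n.-tuple (measurableTypeR R)) :
  n.+1.-tuple (measurableTypeR R) := [tuple of z.1 :: z.2].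

(* Lebesgue measure on R^n: the n-fold product of the one-dimensional one. *)
Fixpoint lebesgue_tuple (n : nat) :
    set (n.-tuple (measurableTypeR R)) -> \bar R :=
  if n is m.+1 then
    pushforward (@lebesgue_measure R \x lebesgue_tuple (n:=m)) (@tcons m)
  else \d_([tuple] : 0.-tuple (measurableTypeR R)).

Lemma measurable_tcons n : measurable_fun [set: _] (@tcons n).
Proof. exact: measurable_cons. Qed.

Lemma lebesgue_tuple_sigma_finite_measure n :
  exists m : {sigma_finite_measure set (n.-tuple (measurableTypeR R)) -> \bar R},
    @lebesgue_tuple n = m.
Proof.
elim: n => [|n [m mE]]; first by exists \d_([tuple]).
pose mu : {sigma_finite_measure set (measurableTypeR R) -> \bar R} :=
  @lebesgue_measure R.
pose nu : {measure set (n.+1.-tuple (measurableTypeR R)) -> \bar R} :=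
  measure_function_pushforward__canonical__measure_function_Measure
    (mu \x m) (@measurable_tcons n).
have snu : sigma_finite [set: _] nu.
  have /sigma_finiteP[F [FT ndF Foo]] := sigma_finiteT mu.
  have /sigma_finiteP[G [GT ndG Goo]] := sigma_finiteT m.
  pose g (z : n.+1.-tuple (measurableTypeR R)) := (thead z, [tuple of behead z]).
  have mg : measurable_fun [set: _] g.
    apply: measurable_fun_pair; first exact: measurable_tnth.
    exact: measurable_behead.
  have gK : cancel (@tcons n) g.
    by case=> x t; congr pair; apply/val_inj.
  exists (fun k => g @^-1` (F k `*` G k)).
    rewrite -preimage_bigcup [X in _ @^-1` X](_ : _ = setT) //.
    apply/seteqP; split=> // -[x y] _.
    have [i _ Fx] : (\bigcup_i F i) x by rewrite -FT.
    have [j _ Gy] : (\bigcup_i G i) y by rewrite -GT.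
    exists (maxn i j) => //; split.
      by move: x Fx; exact/subsetPset/ndF/leq_maxl.
    by move: y Gy; exact/subsetPset/ndG/leq_maxr.
  move=> k; have [mF fF] := Foo k; have [mG fG] := Goo k; split.
    by rewrite -[X in measurable X]setTI; apply: mg => //; exact: measurableX.
  rewrite [ltLHS](_ : _ = (mu \x m) (F k `*` G k)); last first.
    by congr ((mu \x m) _); apply/seteqP; split=> z; rewrite /preimage /mkset gK.
  by rewrite product_measure1E// lte_mul_pinfty// ge0_fin_numE.
have nuE : @lebesgue_tuple n.+1 = nu by rewrite /= mE.
clearbody nu.
by exists (with_sigma_finite snu).
Qed.

Lemma lebesgue_tuple_box n (A : 'I_n -> set (measurableTypeR R)) :
  (forall i, measurable (A i)) ->
  lebesgue_tuple [set z | forall i, A i (tnth z i)] =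
  \prod_(i < n) lebesgue_measure (A i).
Proof.
elim: n A => [|n IHn] A mA.
  by rewrite big_ord0 /= diracE mem_set // => -[].
have [m mE] := lebesgue_tuple_sigma_finite_measure n.
rewrite big_ord_recl -IHn => [|i]; last exact: mA.
rewrite /= mE /pushforward -product_measure1E //.
- congr (_ _); apply/seteqP; split=> -[x t] /=.
    move=> h; split; first exact: (h ord0).
    by move=> i; have := h (lift ord0 i); rewrite tnthS.
  by move=> [h0 h] i; case: (unliftP ord0 i) => [j|] ->; rewrite ?tnthS.
- rewrite (_ : [set _ | _] = \bigcap_i ((fun z => tnth z i) @^-1` A (lift ord0 i))).
    apply: fin_bigcap_measurable => // i _.
    by rewrite -[X in measurable X]setTI; exact: measurable_tnth.
  by apply/seteqP; split=> t /= h i; [move=> _|]; exact: h.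
Qed.

End lebesgue.

Section self_similar.
Context {R : realType} {n : nat}.

Definition spacetime (T : R) : set ('rV[R]_n * R) :=
  [set z | 0 < z.2 < T].

Definition smooth_solution (p T : R) (u : 'rV[R]_n -> R -> R) : Prop :=
  smooth_on (spacetime T) (fun z => u z.1 z.2) /\
  forall (x : 'rV[R]_n) (t : R), 0 < t < T ->
    derive1 (u x) t = laplacian (u ^~ t) x + `|u x t| `^ (p - 1) * u x t.

Definition self_similar (p T : R) (a : 'rV[R]_n) (u : 'rV[R]_n -> R -> R) :
    Prop :=
  forall (l : R) (x : 'rV[R]_n) (t : R),
    0 < l -> 0 < t < T -> 0 < T + l ^+ 2 * (t - T) < T ->
    u x t = l `^ (2 / (p - 1)) * u (a + l *: (x - a)) (T + l ^+ 2 * (t - T)).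

(* The profile w is read off at the time T / 2; for a self-similar u any other
   time in (0, T) gives the same function. *)
Definition profile (p T : R) (a : 'rV[R]_n) (u : 'rV[R]_n -> R -> R)
    (y : 'rV[R]_n) : R :=
  (T / 2) `^ (p - 1)^-1 * u (a + Num.sqrt (T / 2) *: y) (T / 2).

Definition selfsim_ext (p T : R) (a : 'rV[R]_n) (u : 'rV[R]_n -> R -> R)
    (x : 'rV[R]_n) (t : R) : R :=
  (T - t) `^ (- (p - 1)^-1) *
  profile p T a u ((Num.sqrt (T - t))^-1 *: (x - a)).

Lemma selfsim_extE (p T : R) (a : 'rV[R]_n) (u : 'rV[R]_n -> R -> R) :
  self_similar p T a u ->
  forall (x : 'rV[R]_n) (t : R), 0 < t < T -> selfsim_ext p T a u x t = u x t.
Proof.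
move=> ssu x t /andP[t0 tT].
have T0 : 0 < T by exact: lt_trans tT.
have Tt0 : 0 < T - t by rewrite subr_gt0.
pose l := Num.sqrt (T / 2) / Num.sqrt (T - t).
have l0 : 0 < l by rewrite divr_gt0 // sqrtr_gt0 // divr_gt0.
have lE : l ^+ 2 = (T / 2) / (T - t).
  by rewrite expr_div_n !sqr_sqrtr // ltW // divr_gt0.
have timeE : T + l ^+ 2 * (t - T) = T / 2.
  by rewrite lE -(opprB T t) mulrN divfK ?gt_eqF // {1}(splitr T) addrK.
rewrite (ssu l x t) // ?t0 //; last first.
  by rewrite timeE divr_gt0 //= ltr_pdivrMr // ltr_pMr // ltr1n.
rewrite timeE /selfsim_ext /profile scalerA -/l mulrA.
rewrite [in LHS](mulrC (_ `^ _)); congr (_ * _).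
rewrite powRrM powR_mulrn ?ltW // lE.
rewrite [RHS]powRM ?invr_ge0 ?ltW // ?divr_gt0 //.
by rewrite -(@powR_inv1 _ (T - t)) ?ltW // -powRrM mulN1r.
Qed.

End self_similar.

Definition weighted_integral {R : realType} {n : nat} (p T : R) (a : 'rV[R]_n)
    (u : 'rV[R]_n -> R -> R) (t : R) : \bar R :=
  (\int[@lebesgue_tuple R n]_z
    (let x : 'rV[R]_n := \row_i tnth z i in
     `|u x t| `^ (2 * p) * (T - t) `^ (2 * p / (p - 1)) *
     expR (- (sqnorm2 (x - a) / (4 * (T - t)))))%:E)%E.

(* Main.v *)
Require Import Defs.
From HB Require Import structures.
From mathcomp Require Import all_boot all_order all_algebra.
From mathcomp Require Import all_classical all_reals all_analysis.
From mathcomp Require Import ring lra.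
Import Order.TTheory GRing.Theory Num.Theory.
Import numFieldNormedType.Exports.

Set Implicit Arguments.
Unset Strict Implicit.
Unset Printing Implicit Defensive.

Local Open Scope classical_set_scope.
Local Open Scope ring_scope.

(** Put c = 1 / (p - 1). The profile w determines u, and u_t is given in the same
    way by the speed H = c w + (y . grad w) / 2, which is positive by assumption.
    With the Ornstein-Uhlenbeck operator L = Delta - (y . grad) / 2, the equation
    for u and its time derivative read
      L w - c w + |w|^(p-1) w = 0   and   L H - (c + 1) H + p |w|^(p-1) H = 0.
    Along each ray r^(2 c) w(r y) increases, because its derivative is a positive
    multiple of H; so w is positive (profile_gt0), and ln w and ln H make sense.

    The function G = p ln w - ln H satisfies
      L G = |grad G|^2 - 2 p grad ln w . grad G + (p^2 - p) |grad ln w|^2,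
    and therefore, for s = 2 / (p - 1),
      L exp(s G) >= s p (p - 1) / (p + 1) |grad ln w|^2 exp(s G) >= 0.
    The Ornstein-Uhlenbeck process is recurrent, so a subsolution of L of
    polynomial growth is constant (recurrence_barrier, grad_zero). Then w is
    constant, and the first equation gives w = c^c.

    Polynomial growth of w^p / H comes in three steps.
    - H decays at most polynomially, by comparison with a power of 1 + |y|^2
      (H_lower_bound).
    - For beta = (p + 1) / 2 < p, L (beta ln w - ln H) contains the additional term
      (p - beta) (w^(p-1) - c). It is superlinear where w is large, so that a
      Keller-Osserman argument in balls bounds w^beta / H polynomially
      (log_ratio_bound).
    - Hence H is at least w^beta times a negative power of 1 + |y|^2, and
      H = c w + (y . grad w) / 2 becomes a differential inequality along rays whose
      solutions blow up at a finite distance unless w itself grows at most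
      polynomially (log_growth).

    Every maximum principle is applied at a maximum point, to the functions
    obtained by moving that point along the axes and along its ray (ou_jet); for
    H, this uses the symmetry of second derivatives of u (derive_comm). *)

(** * Derivatives and maxima of functions of one variable *)

Section one_variable.
Context {R : realType}.
Implicit Types (f g : R -> R) (t x a b c d : R).

(* The differentiation rules, for functions given by an expression. *)

Lemma derD f g x a b : is_derive x 1 f a -> is_derive x 1 g b ->
  is_derive x 1 (fun t => f t + g t) (a + b).
Proof. exact: is_deriveD. Qed.

Lemma derN f x a : is_derive x 1 f a -> is_derive x 1 (fun t => - f t) (- a).
Proof. exact: is_deriveN. Qed.

Lemma derZ f x a c : is_derive x 1 f a ->
  is_derive x 1 (fun t => c * f t) (c * a).
Proof. exact: is_deriveZ. Qed.

Lemma derM f g x a b : is_derive x 1 f a -> is_derive x 1 g b ->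
  is_derive x 1 (fun t => f t * g t) (f x * b + g x * a).
Proof. exact: is_deriveM. Qed.

Lemma derC f g x a b : is_derive (g x) 1 f a -> is_derive x 1 g b ->
  is_derive x 1 (fun t => f (g t)) (a * b).
Proof. exact: is_derive1_comp. Qed.

Lemma der_cst c x : is_derive x 1 (fun=> c : R) 0.
Proof. exact: is_derive_cst. Qed.

Lemma der_id x : is_derive x 1 (fun t : R => t) 1.
Proof. exact: is_derive_id. Qed.

Lemma der_eq f x a b : is_derive x 1 f a -> a = b -> is_derive x 1 f b.
Proof. by move=> + <-. Qed.

Lemma der_uniq f x a b : is_derive x 1 f a -> is_derive x 1 f b -> a = b.
Proof. by move=> [_ <-] [_ <-]. Qed.

Lemma der_cont f x a : is_derive x 1 f a -> {for x, continuous f}.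
Proof. by move=> [/derivable1_diffP/differentiable_continuous]. Qed.

Lemma der_near f g x a : (\forall t \near x, f t = g t) ->
  is_derive x 1 f a -> is_derive x 1 g a.
Proof. exact: near_eq_is_derive. Qed.

Lemma der_MVT f f' a b : (forall x, is_derive x 1 f (f' x)) -> a < b ->
  exists2 c, a < c < b & f b - f a = f' c * (b - a).
Proof.
move=> df ab; have [|c] := MVT ab (fun x _ => df x).
  by apply: continuous_subspaceT => x; exact: der_cont (df x).
by rewrite in_itv; exists c.
Qed.

Lemma nincr_of_der f f' a b : (forall x, a <= x -> is_derive x 1 f (f' x)) ->
  (forall x, a <= x -> f' x <= 0) -> a <= b -> f b <= f a.
Proof.
move=> df f'0; rewrite le_eqVlt => /orP[/eqP-> //|ab].
have [||c] := @MVT _ f f' a b ab.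
- by move=> x; rewrite in_itv/= => /andP[/ltW ax _]; exact: df.
- apply: derivable_within_continuous => x; rewrite in_itv/= => /andP[ax _].
  by have [] := df x ax.
rewrite in_itv/= => /andP[/ltW ac _] E; rewrite -subr_le0 E.
by rewrite mulr_le0_ge0 ?f'0// subr_ge0 ltW.
Qed.

(** First and second derivative at x. The function f has to be differentiable
    near x only, so that barriers living in a ball are covered. *)
Definition jet2 f x a b : Prop :=
  exists2 f' : R -> R, (\forall t \near x, is_derive (t : R) 1 f (f' t)) &
              f' x = a /\ is_derive x 1 f' b.

Lemma jet2_der f x a b : jet2 f x a b -> is_derive x 1 f a.
Proof. by move=> [f' /nbhs_singleton + [<- _]]. Qed.

Lemma jet2_eq f x a b c d : jet2 f x a b -> a = c -> b = d -> jet2 f x c d.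
Proof. by move=> + <- <-. Qed.

Lemma jet2_of_der f f' x b : (forall t, is_derive t 1 f (f' t)) ->
  is_derive x 1 f' b -> jet2 f x (f' x) b.
Proof. by move=> df df'; exists f'; [by apply: filterE => t; exact: df|]. Qed.

Lemma jet2_cst c x : jet2 (fun=> c) x 0 0.
Proof. by exists (fun=> 0); [apply: filterE => t; exact: der_cst|split=> //; exact: der_cst]. Qed.

Lemma jet2D f g x a b c d : jet2 f x a b -> jet2 g x c d ->
  jet2 (fun t => f t + g t) x (a + c) (b + d).
Proof.
move=> [f' nf [fa fb]] [g' ng [gc gd]]; exists (fun t => f' t + g' t).
  by near=> t; apply: derD; near: t.
by rewrite fa gc; split=> //; exact: derD.
Unshelve. all: by end_near. Qed.

Lemma jet2Z f x a b c : jet2 f x a b -> jet2 (fun t => c * f t) x (c * a) (c * b).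
Proof.
move=> [f' nf [fa fb]]; exists (fun t => c * f' t).
  by near=> t; apply: derZ; near: t.
by rewrite fa; split=> //; exact: derZ.
Unshelve. all: by end_near. Qed.

Lemma jet2N f x a b : jet2 f x a b -> jet2 (fun t => - f t) x (- a) (- b).
Proof.
by move=> /(jet2Z (-1)) J; rewrite -[- a]mulN1r -[- b]mulN1r; under eq_fun do rewrite -mulN1r.
Qed.

Lemma jet2_comp f g x a b c d : jet2 g x a b -> jet2 f (g x) c d ->
  jet2 (fun t => f (g t)) x (c * a) (d * a ^+ 2 + c * b).
Proof.
move=> Jg; have gx := der_cont (jet2_der Jg).
move: Jg => [g' ng [<- gb]] [f' nf [<- fd]].
exists (fun t => f' (g t) * g' t).
  near=> t; apply: derC; last by near: t.
  by near: t; exact: (gx _ nf).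
split=> //; apply: (der_eq (derM (derC fd (nbhs_singleton ng)) gb)).
by ring.
Unshelve. all: by end_near. Qed.

Lemma small_step d e : 0 < d -> 0 < e -> exists2 h, 0 < h & h < d /\ h < e.
Proof.
move=> d0 e0; exists (Num.min d e / 2); first by rewrite divr_gt0// lt_min d0.
have m0 : 0 < Num.min d e by rewrite lt_min d0.
have : Num.min d e <= d /\ Num.min d e <= e by rewrite !ge_min !lexx orbT.
lra.
Qed.

Lemma der_gt0 f x a : is_derive x 1 f a -> 0 < a ->
  exists2 d, 0 < d & forall t, 0 < `|t - x| < d -> 0 < (f t - f x) / (t - x).
Proof.
move=> [df Ea] a0.
have : (h^-1 *: (f (h *: 1 + x) - f x)) @[h --> 0^'] --> a by rewrite -Ea; exact: df.
move=> /(_ _ (lt_nbhsr a0))/nbhs_ballP[d /= d0 Hd]; exists d => // t /andP[t0 td].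
have := Hd (t - x); rewrite [_ *: 1]mulr1 subrK mulrC; apply.
- by rewrite /ball/= sub0r normrN.
- by rewrite -normr_gt0.
Qed.

Lemma der_max f x a : is_derive x 1 f a -> (\forall t \near x, f t <= f x) -> a = 0.
Proof.
move=> df /nbhs_ballP[e /= e0 He]; apply: contrapT => /eqP; rewrite neq_lt.
move=> /orP[a0|a0].
- have [|d d0 Hd] := der_gt0 (derN df); first by rewrite oppr_gt0.
  have [h h0 [hd he]] := small_step d0 e0.
  have := He (x - h); rewrite /ball/= opprB addrCA subrr addr0 gtr0_norm// => /(_ he).
  have := Hd (x - h); rewrite addrAC subrr add0r normrN gtr0_norm// h0 => /(_ hd).
  by rewrite invrN mulrN -mulNr pmulr_lgt0 ?invr_gt0//; lra.
- have [d d0 Hd] := der_gt0 df a0.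
  have [h h0 [hd he]] := small_step d0 e0.
  have := He (x + h); rewrite /ball/= opprD addNKr normrN gtr0_norm// => /(_ he).
  have := Hd (x + h); rewrite addrAC subrr add0r gtr0_norm// h0 => /(_ hd).
  by rewrite pmulr_lgt0 ?invr_gt0//; lra.
Qed.

(** Were the second derivative positive, the first one would be positive just to
    the right of x, and f would increase there. *)
Lemma jet2_max f x a b : jet2 f x a b -> (\forall t \near x, f t <= f x) ->
  a = 0 /\ b <= 0.
Proof.
move=> Jf nmax; have a0 := der_max (jet2_der Jf) nmax; split=> //.
move: Jf => [f' nf [f'x fb]]; rewrite {}a0 in f'x.
rewrite leNgt; apply/negP => b0.
have [e /= e0 He] := (nbhs_ballP _ _).1 (filterI nf nmax).
have {}He t : x - e < t < x + e -> is_derive t 1 f (f' t) /\ f t <= f x.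
  by move=> Ht; apply: He; rewrite /ball/= ltr_distlC; lra.
have [d d0 Hd] := der_gt0 fb b0.
have [h h0 [hd he]] := small_step d0 e0.
have f'pos t : x < t < x + h -> 0 < f' t.
  move=> Ht; have := Hd t; have tx : 0 < t - x by lra.
  by rewrite f'x subr0 gtr0_norm// pmulr_lgt0 ?invr_gt0//; apply; lra.
have xh : x < x + h by lra.
have [||c] := @MVT _ f f' x (x + h) xh.
- by move=> t; rewrite in_itv/= => Ht; apply He; lra.
- apply: derivable_within_continuous => t; rewrite in_itv/= => Ht.
  by have [] := (He t ltac:(lra)).1.
rewrite in_itv/= => /f'pos f'c E.
have := (He (x + h) ltac:(lra)).2.
have : 0 < f (x + h) - f x by rewrite E; apply: mulr_gt0 => //; lra.
lra.
Qed.

Lemma jet2_ln x : 0 < x -> jet2 (@ln R) x x^-1 (- x ^- 2).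
Proof.
move=> x0; exists GRing.inv.
  by near=> t; apply: is_derive1_ln; near: t; exact: lt_nbhsr.
split=> //; have x0' : x != 0 by rewrite gt_eqF.
have dV : is_derive x 1 (fun t : R => (id t)^-1) (- x ^- 2).
  split; first exact: (@derivableV _ _ id).
  by rewrite (@deriveV _ _ id)// derive_id /GRing.scale/= mulr1.
exact: dV.
Unshelve. all: by end_near. Qed.

Lemma jet2_expR x : jet2 (@expR R) x (expR x) (expR x).
Proof. exact: jet2_of_der. Qed.

Lemma jet2_quadratic a b x :
  jet2 (fun t => a * t + b * t ^+ 2) x (a + 2 * b * x) (2 * b).
Proof.
have dsq t : is_derive t 1 (fun t : R => t ^+ 2) (2 * t).
  have := derM (der_id t) (der_id t); under eq_fun do rewrite -expr2.
  by move/der_eq; apply; ring.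
apply: (@jet2_of_der _ (fun t => a + 2 * b * t)).
  move=> t; apply: (der_eq (derD (derZ a (der_id t)) (derZ b (dsq t)))); ring.
apply: (der_eq (derD (der_cst a x) (derZ (2 * b) (der_id x)))); ring.
Qed.

End one_variable.

(** * The Ornstein-Uhlenbeck operator *)

Section continuity.
Context {R : realType} {V : topologicalType}.
Implicit Types (f g : V -> R).

Lemma contD f g : continuous f -> continuous g -> continuous (fun y => f y + g y).
Proof. by move=> cf cg x; apply: continuousD; [exact: cf|exact: cg]. Qed.

Lemma contN f : continuous f -> continuous (fun y => - f y).
Proof. by move=> cf x; apply: continuousN; exact: cf. Qed.

Lemma contM f g : continuous f -> continuous g -> continuous (fun y => f y * g y).
Proof. by move=> cf cg x; apply: continuousM; [exact: cf|exact: cg]. Qed.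

Lemma contZ (a : R) f : continuous f -> continuous (fun y => a * f y).
Proof. by apply: contM => x; exact: cst_continuous. Qed.

Lemma cont_comp (phi : R -> R) f : continuous f ->
  (forall y, {for f y, continuous phi}) -> continuous (fun y => phi (f y)).
Proof. by move=> cf cphi x; apply: continuous_comp; [exact: cf|exact: cphi]. Qed.

End continuity.

Section ornstein_uhlenbeck.
Context {R : realType} {n : nat}.
Local Notation V := 'rV[R]_n.
Implicit Types (f : V -> R) (x y : V) (g h : 'I_n -> R) (d : R).

Definition dot x y : R := \sum_(i < n) x 0 i * y 0 i.

(** The derivatives of f at y that the maximum principle uses: g and h list the
    first and second derivatives along the coordinate axes, d is the radial
    derivative y . grad f. The latter is taken along the ray exp(t) y, which is
    again a function of one variable, so that total differentiability of f does
    not enter. *)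
Definition ou_jet f y g h d : Prop :=
  (forall i, jet2 (fun t => f (y + t *: delta_mx 0 i)) 0 (g i) (h i)) /\
  is_derive (0 : R) 1 (fun t : R => f (expR t *: y)) d.

(** The Ornstein-Uhlenbeck operator L f = Delta f - (y . grad f) / 2, in terms of
    the derivatives listed by ou_jet. *)
Definition ou h d : R := \sum_(i < n) h i - d / 2.

Lemma ou_jet_comp (phi : R -> R) f y g h d a b : ou_jet f y g h d ->
  jet2 phi (f y) a b ->
  ou_jet (fun x => phi (f x)) y (fun i => a * g i)
    (fun i => b * g i ^+ 2 + a * h i) (a * d).
Proof.
move=> [Ji Jr] Jphi; split=> [i|].
  by apply: (jet2_comp (Ji i)); rewrite scale0r addr0.
by apply: (@derC _ phi _ _ _ _ _ Jr); rewrite expR0 scale1r; exact: jet2_der Jphi.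
Qed.

Lemma ou_jetD f f' y g g' h h' d d' : ou_jet f y g h d -> ou_jet f' y g' h' d' ->
  ou_jet (fun x => f x + f' x) y (fun i => g i + g' i) (fun i => h i + h' i)
    (d + d').
Proof. by move=> [Ji Jr] [Ji' Jr']; split=> [i|]; [exact: jet2D|exact: derD]. Qed.

Lemma ou_jetZ c f y g h d : ou_jet f y g h d ->
  ou_jet (fun x => c * f x) y (fun i => c * g i) (fun i => c * h i) (c * d).
Proof. by move=> [Ji Jr]; split=> [i|]; [exact: jet2Z|exact: derZ]. Qed.

Lemma ou_jetN f y g h d : ou_jet f y g h d ->
  ou_jet (fun x => - f x) y (fun i => - g i) (fun i => - h i) (- d).
Proof. by move=> [Ji Jr]; split=> [i|]; [exact: jet2N|exact: derN]. Qed.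

Lemma ou_jet_cst c y : ou_jet (fun=> c) y (fun=> 0) (fun=> 0) 0.
Proof. by split=> [i|]; [exact: jet2_cst|exact: der_cst]. Qed.

Lemma ouD h h' d d' :
  ou (fun i => h i + h' i) (d + d') = ou h d + ou h' d'.
Proof. by rewrite /ou big_split/=; lra. Qed.

Lemma ouZ c h d : ou (fun i => c * h i) (c * d) = c * ou h d.
Proof. by rewrite /ou -mulr_sumr; lra. Qed.

Lemma ouN h d : ou (fun i => - h i) (- d) = - ou h d.
Proof. by rewrite /ou sumrN; lra. Qed.

Lemma ou_jet_max f y g h d : ou_jet f y g h d -> (\forall x \near y, f x <= f y) ->
  (forall i, g i = 0) /\ ou h d <= 0.
Proof.
move=> [Ji Jr] ymax.
have gh i : g i = 0 /\ h i <= 0.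
  apply: (jet2_max (Ji i)).
  have c : {for (0 : R), continuous (fun t : R => y + t *: (delta_mx 0 i : V))}.
    move=> t; apply: (@cvgD _ _ _ _ _ (fun=> y)); first exact: cvg_cst.
    by apply: cvgZr_tmp; exact: cvg_id.
  have c0 : nbhs (y + 0 *: (delta_mx 0 i : V)) [set x | f x <= f y].
    by rewrite scale0r addr0.
  by rewrite scale0r addr0; exact: (c _ c0).
have c : {for (0 : R), continuous (fun t : R => expR t *: y)}.
  by move=> t; apply: cvgZr_tmp; exact: continuous_expR.
suff d0 : d = 0.
  split=> [i|]; first exact: (gh i).1.
  by rewrite /ou d0 mul0r subr0 sumr_le0// => i _; exact: (gh i).2.
have nmax : \forall t \near (0 : R), f (expR t *: y) <= f (expR 0 *: y).
  have c0 : nbhs (expR 0 *: y) [set x | f x <= f y] by rewrite expR0 scale1r.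
  by rewrite expR0 scale1r; exact: (c _ c0).
exact: (der_max Jr nmax).
Qed.

Lemma sqnorm2_ge0 y : 0 <= sqnorm2 y.
Proof. by apply: sumr_ge0 => i _; exact: sqr_ge0. Qed.

Lemma dotxx y : dot y y = sqnorm2 y.
Proof. by []. Qed.

Lemma ou_jet_sqnorm2 x0 y : ou_jet (fun x => sqnorm2 (x - x0)) y
  (fun i => 2 * (y - x0) 0 i) (fun=> 2) (2 * dot y (y - x0)).
Proof.
split=> [i|].
- have -> : (fun t => sqnorm2 (y + t *: delta_mx 0 i - x0)) =
      fun t => sqnorm2 (y - x0) + (2 * (y - x0) 0 i * t + 1 * t ^+ 2).
    apply/funext => t; rewrite /sqnorm2 (bigD1 i)//= [in RHS](bigD1 i)//=.
    rewrite [X in _ + X = _](eq_bigr (fun j => (y - x0) 0 j ^+ 2)); last first.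
      by move=> j ji; rewrite !mxE (negbTE ji) andbF /=; ring.
    by rewrite !mxE !eqxx /=; ring.
  by apply: (jet2_eq (jet2D (jet2_cst _ 0) (jet2_quadratic _ 1 0))); ring.
- have dex (i : 'I_n) : is_derive (0 : R) 1 (fun t : R => (expR t *: y - x0) 0 i ^+ 2)
      (2 * (y 0 i * (y - x0) 0 i)).
    have d1 : is_derive (0 : R) 1 (fun t : R => y 0 i * expR t + - x0 0 i) (y 0 i).
      by apply: (der_eq (derD (derZ _ (is_derive_expR 0)) (der_cst _ _))); rewrite expR0; ring.
    have -> : (fun t : R => (expR t *: y - x0) 0 i ^+ 2) =
        fun t => (y 0 i * expR t + - x0 0 i) * (y 0 i * expR t + - x0 0 i).
      by apply/funext => t; rewrite !mxE; ring.
    by apply: (der_eq (derM d1 d1)); rewrite expR0 !mxE; ring.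
  have := is_derive_sum dex.
  rewrite -mulr_sumr => D; apply: (der_eq _ (erefl _)).
  by rewrite (_ : (fun _ => _) = \sum_(i < n) (fun t : R => (expR t *: y - x0) 0 i ^+ 2))//;
    apply/funext => t; rewrite fct_sumE.
Qed.

Lemma ou_jet_radial (phi : R -> R) x0 y a b : jet2 phi (sqnorm2 (y - x0)) a b ->
  exists g h d, ou_jet (fun x => phi (sqnorm2 (x - x0))) y g h d /\
  [/\ forall i, g i = 2 * a * (y - x0) 0 i,
      \sum_(i < n) g i ^+ 2 = 4 * a ^+ 2 * sqnorm2 (y - x0) &
      ou h d = 4 * b * sqnorm2 (y - x0) + 2 * n%:R * a - a * dot y (y - x0)].
Proof.
move=> J; have K := ou_jet_comp (ou_jet_sqnorm2 x0 y) J.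
eexists; eexists; eexists; split; first exact: K.
split.
- by move=> i; ring.
- by rewrite /sqnorm2 mulr_sumr; apply: eq_bigr => i _; ring.
- rewrite /ou big_split/= sumr_const card_ord -mulr_natl.
  rewrite (_ : \sum_(i < n) b * _ = 4 * b * sqnorm2 (y - x0)); first by field.
  by rewrite /sqnorm2 mulr_sumr; apply: eq_bigr => i _; ring.
Qed.

Lemma sqnorm2_continuous x0 : continuous (fun x : V => sqnorm2 (x - x0)).
Proof.
apply: (@continuous_big R _ +%R 0 xpredT _ _ _ (fun i x => (x - x0) 0 i ^+ 2)).
  by move=> z; exact: add_continuous.
move=> i _ y.
have c : (fun x : V => (x - x0) 0 i) @ y --> (y - x0) 0 i.
  have -> : (fun x : V => (x - x0) 0 i) = (fun x => x 0 i - x0 0 i).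
    by apply/funext => x; rewrite !mxE.
  rewrite !mxE; have c := @coord_continuous R 1 n 0 i y.
  exact: (cvgB c (cvg_cst (x0 0 i))).
exact: (cvgM c c).
Qed.

Lemma sqnorm2_le_max (F : V -> R) r : 0 <= r -> continuous F ->
  exists2 y, sqnorm2 y <= r & forall x, sqnorm2 x <= r -> F x <= F y.
Proof.
move=> r0 cF; pose A := [set x : V | sqnorm2 x <= r].
have A0 : A !=set0.
  by exists 0; rewrite /A/= /sqnorm2 big1// => i _; rewrite mxE expr0n.
have cA : compact A.
  apply: bounded_closed_compact.
    exists (1 + r); split; first by rewrite num_real.
    move=> M rM x Ax /=; rewrite [`|x|](_ : _ = mx_norm x)//.
    rewrite mx_normrE; apply/bigmax_leP; split=> /=; first by lra.
    move=> [i j] _ /=; rewrite ord1 {i}.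
    have : x 0 j ^+ 2 <= r.
      apply: le_trans Ax; rewrite /sqnorm2 (bigD1 j)//= lerDl.
      by apply: sumr_ge0 => i _; exact: sqr_ge0.
    rewrite -real_normK ?num_real// => xr.
    have := normr_ge0 (x 0 j); nra.
  have -> : A = (fun x => sqnorm2 (x - 0)) @^-1` [set t | t <= r].
    by apply/seteqP; split=> x /=; rewrite subr0.
  apply: preimage_closed; first by move=> x _; exact: sqnorm2_continuous.
  exact: closed_le.
have [y] := EVT_max_rV A0 cA (continuous_subspaceT cF).
rewrite inE => Ay ymax; exists y => // x xr; apply: ymax; rewrite inE; exact: xr.
Qed.

(** Far away F lies below a value that it takes, and balls are compact. *)
Lemma max_attained (F : V -> R) x0 r : continuous F ->
  (forall x, r < sqnorm2 x -> F x < F x0) -> exists y, forall x, F x <= F y.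
Proof.
move=> cF far; pose r' := Num.max r (sqnorm2 x0).
have [|y yr ymax] := @sqnorm2_le_max F r' _ cF.
  by rewrite /r' le_max sqnorm2_ge0 orbT.
exists y => x; have [xr|xr] := leP (sqnorm2 x) r'; first exact: ymax.
apply: (@le_trans _ _ (F x0)); last by apply: ymax; rewrite /r' le_max lexx orbT.
by apply/ltW/far; rewrite (le_lt_trans _ xr)// /r' le_max lexx.
Qed.

(** Real powers of 1 + |y|^2, in exponential form. *)
Definition bracket (k : R) y : R := expR (k * ln (1 + sqnorm2 y)).

Lemma bracket_gt0 k y : 0 < bracket k y. Proof. exact: expR_gt0. Qed.

Lemma le_bracket k l y : k <= l -> bracket k y <= bracket l y.
Proof.
move=> kl; rewrite ler_expR ler_wpM2r// ln_ge0//.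
by rewrite lerDl sqnorm2_ge0.
Qed.

Lemma sqnorm2B0 y : sqnorm2 (y - 0) = sqnorm2 y. Proof. by rewrite subr0. Qed.

Lemma jet2_pow_onep k (t : R) : 0 <= t ->
  jet2 (fun t => expR (k * ln (1 + t))) t
    (k / (1 + t) * expR (k * ln (1 + t)))
    (k * (k - 1) / (1 + t) ^+ 2 * expR (k * ln (1 + t))).
Proof.
move=> t0; have t1 : 0 < 1 + t by lra.
have J1 : jet2 (fun t : R => 1 + t) t 1 0.
  rewrite (_ : (fun t : R => 1 + t) = fun t : R => 1 + (1 * t + 0 * t ^+ 2)).
    by apply: (jet2_eq (jet2D (jet2_cst 1 _) (jet2_quadratic 1 0 _))); ring.
  by apply/funext => u; ring.
have J := jet2_comp (jet2Z k (jet2_comp J1 (jet2_ln t1))) (jet2_expR _).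
by apply: (jet2_eq J); field; rewrite gt_eqF.
Qed.

Lemma sqnorm2_cont : continuous (sqnorm2 : V -> R).
Proof.
rewrite (_ : sqnorm2 = fun y => sqnorm2 (y - 0)); first exact: sqnorm2_continuous.
by apply/funext => y; rewrite subr0.
Qed.

Lemma bracket_continuous k : continuous (bracket k).
Proof.
apply: (@cont_comp R V (fun t => expR (k * ln (1 + t))) _ sqnorm2_cont) => y.
exact: der_cont (jet2_der (jet2_pow_onep k (sqnorm2_ge0 y))).
Qed.

Lemma bracket_lt k e : 0 < k -> 0 < e ->
  exists r, forall y, r < sqnorm2 y -> bracket (- k) y < e.
Proof.
move=> k0 e0; exists (expR (- ln e / k)) => y yr.
have y0 : 0 < 1 + sqnorm2 y by rewrite ltr_pwDl// sqnorm2_ge0.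
rewrite -[X in _ < X](@lnK _ e) ?posrE// ltr_expR.
have : - ln e / k < ln (1 + sqnorm2 y).
  by rewrite -ltr_expR lnK ?posrE//; lra.
rewrite ltr_pdivrMr//; lra.
Qed.

Lemma ou_jet_bracket k y : exists g h d, ou_jet (bracket k) y g h d /\
  ou h d = bracket k y * (4 * k * (k - 1) * sqnorm2 y / (1 + sqnorm2 y) ^+ 2
                          + k * (2 * n%:R - sqnorm2 y) / (1 + sqnorm2 y)).
Proof.
have y0 : 0 < 1 + sqnorm2 y by rewrite ltr_pwDl// sqnorm2_ge0.
have := jet2_pow_onep k (sqnorm2_ge0 (y - 0)).
move=> /ou_jet_radial[g [h [d [J [_ _ E]]]]].
exists g, h, d; split.
  by move: J; under eq_fun do rewrite sqnorm2B0.
by rewrite E !subr0 dotxx /bracket; field; rewrite gt_eqF.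
Qed.

End ornstein_uhlenbeck.

(** * The maximum principle for ln w and ln H *)

Section profile.
Context {R : realType} {n : nat}.
Local Notation V := 'rV[R]_n.
Context (p : R) (w H DH : V -> R) (w1 w2 H1 H2 : V -> 'I_n -> R).
Local Notation c := ((p - 1)^-1).
Context (p_gt1 : 1 < p) (w_gt0 : forall y, 0 < w y) (H_gt0 : forall y, 0 < H y).
Context (w_jet : forall y, ou_jet w y (w1 y) (w2 y) (2 * H y - 2 * c * w y)).
Context (H_jet : forall y, ou_jet H y (H1 y) (H2 y) (DH y)).
Context (w_eq : forall y, \sum_(i < n) w2 y i + w y `^ p = H y).
Context (H_eq : forall y, ou (H2 y) (DH y) - (c + 1) * H y
                          + p * w y `^ (p - 1) * H y = 0).
Context (w_cont : continuous w) (H_cont : continuous H).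
Context (w1_cont : forall i, continuous (w1 ^~ i)).

Lemma exponent_gt0 : 0 < c. Proof. by rewrite invr_gt0 subr_gt0. Qed.

Lemma exponent_mulp : p * c = c + 1.
Proof.
have : p - 1 != 0 by rewrite gt_eqF// subr_gt0.
by move=> p1; field.
Qed.

Definition grad_ln (y : V) (i : 'I_n) : R := (w y)^-1 * w1 y i.

Lemma powR_pred y : w y `^ p = w y * w y `^ (p - 1).
Proof.
rewrite -{2}(powRr1 (ltW (w_gt0 y))) -powRD; first by congr (_ `^ _); ring.
by rewrite (gt_eqF (w_gt0 y)) implybT.
Qed.

(** With v = ln w and h = ln H the two equations become
    L v + |grad v|^2 + (w^(p-1) - c) = 0 and
    L h + |grad h|^2 + p (w^(p-1) - c) = 0, hence
    L (beta v - h) = |grad h|^2 - beta |grad v|^2 + (p - beta) (w^(p-1) - c).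
    Where beta v - h - phi is maximal, grad h = beta grad v - grad phi and
    L (beta v - h) <= L phi. *)
Lemma log_max_principle (beta : R) (phi : V -> R) y g h d :
  ou_jet phi y g h d ->
  (\forall x \near y, beta * ln (w x) - ln (H x) - phi x <=
                      beta * ln (w y) - ln (H y) - phi y) ->
  \sum_(i < n) ((beta * grad_ln y i - g i) ^+ 2 - beta * grad_ln y i ^+ 2)
    + (p - beta) * (w y `^ (p - 1) - c) <= ou h d.
Proof.
move=> Jphi ymax.
have Jv := ou_jet_comp (w_jet y) (jet2_ln (w_gt0 y)).
have Jh := ou_jet_comp (H_jet y) (jet2_ln (H_gt0 y)).
have J := ou_jetD (ou_jetD (ou_jetZ beta Jv) (ou_jetN Jh)) (ou_jetN Jphi).
have [grad0] := ou_jet_max J ymax.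
rewrite !ouD !ouZ !ouN.
have w0 : w y != 0 by rewrite gt_eqF.
have H0 : H y != 0 by rewrite gt_eqF.
have -> : ou (fun i => - w y ^- 2 * w1 y i ^+ 2 + (w y)^-1 * w2 y i)
    ((w y)^-1 * (2 * H y - 2 * c * w y)) =
    - \sum_(i < n) grad_ln y i ^+ 2 - (w y `^ (p - 1) - c).
  rewrite /ou big_split/= -!mulr_sumr.
  have -> : \sum_(i < n) w2 y i = H y - w y * w y `^ (p - 1).
    by rewrite -w_eq powR_pred addrK.
  have -> : \sum_(i < n) grad_ln y i ^+ 2 = w y ^- 2 * \sum_(i < n) w1 y i ^+ 2.
    by rewrite mulr_sumr; apply: eq_bigr => i _; rewrite exprMn exprVn.
  have -> : (w y)^-1 * (2 * H y - 2 * c * w y) / 2 = H y / w y - c.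
    by move: c => c'; field.
  have -> : (w y)^-1 * (H y - w y * w y `^ (p - 1)) = H y / w y - w y `^ (p - 1).
    by field.
  lra.
have -> : ou (fun i => - H y ^- 2 * H1 y i ^+ 2 + (H y)^-1 * H2 y i)
    ((H y)^-1 * DH y) =
    - \sum_(i < n) (beta * grad_ln y i - g i) ^+ 2 - p * (w y `^ (p - 1) - c).
  have -> : - \sum_(i < n) (beta * grad_ln y i - g i) ^+ 2 =
      \sum_(i < n) (- H y ^- 2 * H1 y i ^+ 2).
    rewrite -sumrN; apply: eq_bigr => i _.
    have -> : beta * grad_ln y i - g i = (H y)^-1 * H1 y i.
      by have := grad0 i; rewrite /grad_ln; lra.
    by rewrite exprMn exprVn mulNr.
  have -> : p * (w y `^ (p - 1) - c) = - ((H y)^-1 * ou (H2 y) (DH y)).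
    have -> : ou (H2 y) (DH y) = (c + 1) * H y - p * w y `^ (p - 1) * H y.
      by have := H_eq y; lra.
    by rewrite -exponent_mulp; move: c => c'; field.
  by rewrite /ou big_split/= -!mulr_sumr; lra.
by rewrite sumrB -mulr_sumr; lra.
Qed.


(** One has L H < (c + 1) H, while L phi >= (c + 1) phi far out for the function
    phi = (1 + |y|^2)^(- 2 (c + 1)), so H cannot decay faster than phi. *)
Lemma H_lower_bound : exists2 a, 0 < a &
  forall y, a * bracket (- (2 * (c + 1))) y <= H y.
Proof.
have c0 := exponent_gt0; have N0 : 0 <= n%:R :> R by exact: ler0n.
set m := 2 * (c + 1); have m0 : 0 < m by rewrite /m; lra.
have [||y1 _ y1min] := @sqnorm2_le_max _ _ (fun x => - H x) (1 + 4 * n%:R).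
- lra.
- exact: contN.
exists (H y1 / 2); first by rewrite divr_gt0.
set a := H y1 / 2; have a0 : 0 < a by rewrite divr_gt0.
pose D x := a * bracket (- m) x - H x.
move=> y0; rewrite -subr_le0 -/(D y0) leNgt; apply/negP => D0.
have cD : continuous D.
  by apply: contD; [apply: contZ; exact: bracket_continuous|exact: contN].
have [r far] := @bracket_lt _ n m (D y0 / a) m0 (divr_gt0 D0 a0).
have [|y ymax] := @max_attained _ _ D y0 r cD.
  move=> x /far; rewrite ltr_pdivlMr// => bx.
  by have := H_gt0 x; rewrite [D x]/D; lra.
have Dy : 0 < D y := lt_le_trans D0 (ymax y0).
have yr : 1 + 4 * n%:R < sqnorm2 y.
  rewrite ltNge; apply/negP => /y1min; have : bracket (- m) y <= bracket 0 y.
    by apply: le_bracket; lra.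
  rewrite [bracket 0 y]/bracket mul0r expR0 => b1.
  have : a * bracket (- m) y <= a by rewrite ler_piMr// ltW.
  by move: Dy; rewrite /D /a; have := H_gt0 y1; lra.
have [g [h [d [J E]]]] := ou_jet_bracket (- m) y.
have [|_] := ou_jet_max (ou_jetD (ou_jetZ a J) (ou_jetN (H_jet y))).
  by apply: filterE => x; exact: ymax.
rewrite ouD ouZ ouN E; apply/negP; rewrite -ltNge.
have Hy := H_eq y.
have W0 : 0 < p * w y `^ (p - 1) * H y.
  by apply: mulr_gt0 => //; apply: mulr_gt0; [exact: lt_trans p_gt1|exact: powR_gt0].
set b := bracket (- m) y in E *; have b0 : 0 < b by exact: bracket_gt0.
set t := sqnorm2 y in yr *.
suff : (c + 1) * b <= b * (4 * - m * (- m - 1) * t / (1 + t) ^+ 2 +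
    - m * (2 * n%:R - t) / (1 + t)).
  move/(ler_wpM2l (ltW a0)); rewrite mulrCA -/t => K.
  have : 0 < (c + 1) * D y by rewrite mulr_gt0//; lra.
  by rewrite /D mulrBr -/b; lra.
rewrite mulrC ler_pM2l//.
have t1 : 0 < 1 + t by lra.
have -> : c + 1 = m / 2 by rewrite /m; lra.
apply: (@le_trans _ _ (- m * (2 * n%:R - t) / (1 + t))).
  by rewrite ler_pdivlMr//; nra.
rewrite lerDr; apply: divr_ge0; last exact: sqr_ge0.
by nra.
Qed.

End profile.

(** * A Keller-Osserman bound *)

Section keller_osserman.
Context {R : realType} {n : nat}.
Local Notation V := 'rV[R]_n.

Lemma ou_jet_ball_barrier (k r : R) (y : V) : sqnorm2 y < r ->
  exists g h d, [/\ ou_jet (fun x => - k * ln (r - sqnorm2 x)) y g h d,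
    \sum_(i < n) g i ^+ 2 = 4 * k ^+ 2 * sqnorm2 y / (r - sqnorm2 y) ^+ 2 &
    ou h d = 4 * k * sqnorm2 y / (r - sqnorm2 y) ^+ 2
             + k * (2 * n%:R - sqnorm2 y) / (r - sqnorm2 y)].
Proof.
move=> yr; have e0 : 0 < r - sqnorm2 y by rewrite subr_gt0.
have J1 : jet2 (fun t : R => r - t) (sqnorm2 y) (- 1) 0.
  rewrite (_ : (fun t : R => r - t) = fun t : R => r + (- 1 * t + 0 * t ^+ 2)).
    by apply: (jet2_eq (jet2D (jet2_cst r _) (jet2_quadratic (- 1) 0 _))); ring.
  by apply/funext => u; ring.
have := jet2Z (- k) (jet2_comp J1 (jet2_ln e0)).
rewrite -{1}(sqnorm2B0 y) => /ou_jet_radial[g [h [d [J [_ G E]]]]].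
exists g, h, d; split.
- by move: J; under eq_fun do rewrite sqnorm2B0.
- by rewrite G sqnorm2B0; field; rewrite gt_eqF.
- by rewrite E !subr0 dotxx; field; rewrite gt_eqF.
Qed.

Lemma complete_square (b X g : R) : 1 < b ->
  - (g ^+ 2 / (b - 1)) <= (b * X - g) ^+ 2 - b * X ^+ 2.
Proof.
move=> b1; rewrite -subr_ge0.
have -> : (b * X - g) ^+ 2 - b * X ^+ 2 - - (g ^+ 2 / (b - 1)) =
    b / (b - 1) * ((b - 1) * X - g) ^+ 2.
  by field; rewrite gt_eqF// subr_gt0.
by rewrite mulr_ge0 ?sqr_ge0// divr_ge0//; lra.
Qed.

Context (p : R) (w H DH : V -> R) (w1 w2 H1 H2 : V -> 'I_n -> R).
Local Notation c := ((p - 1)^-1).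
Context (p_gt1 : 1 < p) (w_gt0 : forall y, 0 < w y) (H_gt0 : forall y, 0 < H y).
Context (w_jet : forall y, ou_jet w y (w1 y) (w2 y) (2 * H y - 2 * c * w y)).
Context (H_jet : forall y, ou_jet H y (H1 y) (H2 y) (DH y)).
Context (w_eq : forall y, \sum_(i < n) w2 y i + w y `^ p = H y).
Context (H_eq : forall y, ou (H2 y) (DH y) - (c + 1) * H y
                          + p * w y `^ (p - 1) * H y = 0).
Context (w_cont : continuous w) (H_cont : continuous H).

(** The quadratic terms in grad ln w have a sign for beta = (p + 1) / 2 > 1 up to
    |grad phi|^2, and p - beta is positive: what remains bounds w^(p-1). *)
Lemma w_local_bound (k r : R) y : 0 <= k -> 1 <= r -> sqnorm2 y < r ->
  (\forall x \near y,
    (p + 1) / 2 * ln (w x) - ln (H x) - (- k * ln (r - sqnorm2 x)) <=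
    (p + 1) / 2 * ln (w y) - ln (H y) - (- k * ln (r - sqnorm2 y))) ->
  w y `^ (p - 1) <= (c + 2 * c * (4 * k + 2 * n%:R * k + 8 * c * k ^+ 2) + 1)
                    * (r / (r - sqnorm2 y)) ^+ 2.
Proof.
move=> k0 r1 yr ymax.
have [g [h [d [J G E]]]] := ou_jet_ball_barrier k yr.
have p1 := p_gt1; have c0 : 0 < c := exponent_gt0 p_gt1.
have := log_max_principle p_gt1 w_gt0 H_gt0 w_jet H_jet w_eq H_eq J ymax.
set S := \sum_(i < n) _; set W := w y `^ (p - 1).
have b1 : 1 < (p + 1) / 2 by lra.
have {b1} : - (\sum_(i < n) g i ^+ 2 / ((p + 1) / 2 - 1)) <= S.
  by rewrite -sumrN; apply: ler_sum => i _; exact: complete_square.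
rewrite -mulr_suml {}G {}E.
have -> : ((p + 1) / 2 - 1)^-1 = 2 * c by field; lra.
have -> : p - (p + 1) / 2 = (2 * c)^-1 by rewrite invfM invrK; lra.
set e := r - sqnorm2 y; set t := sqnorm2 y in yr e *.
have t0 : 0 <= t := sqnorm2_ge0 y.
have N0 : 0 <= n%:R :> R := ler0n _ _.
have e0 : 0 < e by rewrite subr_gt0.
set q := r / e ^+ 2.
have q0 : 0 <= q by rewrite divr_ge0 ?sqr_ge0//; lra.
have tq : t / e ^+ 2 <= q by rewrite ler_wpM2r ?invr_ge0 ?sqr_ge0// ltW.
have eq' : e^-1 <= q.
  by rewrite ler_pdivlMr ?exprn_gt0// expr2 mulKf ?gt_eqF//; rewrite /e; lra.
have rq : q <= (r / e) ^+ 2.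
  rewrite expr_div_n; rewrite ler_wpM2r ?invr_ge0 ?sqr_ge0//.
  by rewrite expr2 ler_pMr//; lra.
have re1 : 1 <= (r / e) ^+ 2.
  rewrite -[X in X <= _](expr1n _ 2) lerXn2r ?nnegrE//; first by rewrite divr_ge0//; lra.
  by rewrite ler_pdivlMr//; rewrite /e; lra.
move=> lowS upS.
have k1 : 4 * k * t / e ^+ 2 <= 4 * k * q by rewrite -mulrA ler_wpM2l//; lra.
have k2 : k * (2 * n%:R - t) / e <= 2 * n%:R * k * q.
  have -> : 2 * n%:R * k * q = k * (2 * n%:R) * q by ring.
  apply: (@le_trans _ _ (k * (2 * n%:R) / e)).
    by rewrite ler_wpM2r ?invr_ge0 ?(ltW e0)// ler_wpM2l//; lra.
  by rewrite ler_wpM2l// mulr_ge0//; lra.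
have k3 : 4 * k ^+ 2 * t / e ^+ 2 * (2 * c) <= 8 * c * k ^+ 2 * q.
  have -> : 8 * c * k ^+ 2 * q = (4 * k ^+ 2 * q) * (2 * c) by ring.
  rewrite ler_wpM2r//; first lra.
  by rewrite -mulrA ler_wpM2l//; apply: mulr_ge0; [lra|exact: sqr_ge0].
set A := 4 * k + 2 * n%:R * k + 8 * c * k ^+ 2.
have : (2 * c)^-1 * (W - c) <= A * q.
  have -> : A * q = 4 * k * q + 2 * n%:R * k * q + 8 * c * k ^+ 2 * q.
    by rewrite /A; ring.
  move: lowS upS k1 k2 k3; move: (4 * k * t / e ^+ 2) (k * (2 * n%:R - t) / e)
    ((2 * c)^-1 * (W - c)) (4 * k ^+ 2 * t / e ^+ 2 * (2 * c)) (4 * k * q)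
    (2 * n%:R * k * q) (8 * c * k ^+ 2 * q) => *; lra.
rewrite mulrC ler_pdivrMr; last lra.
have A0 : 0 <= A.
  have : 0 <= c * k ^+ 2 by rewrite mulr_ge0 ?sqr_ge0// ltW.
  by have : 0 <= n%:R * k by [rewrite mulr_ge0]; rewrite /A; lra.
move: rq re1; set Q := (r / e) ^+ 2 => rq re1.
have AqQ : A * q * (2 * c) <= A * Q * (2 * c).
  by rewrite ler_wpM2r//; [lra|rewrite ler_wpM2l].
move=> /le_trans/(_ AqQ) WA.
have cQ : c <= c * Q by rewrite ler_peMr// ltW.
have -> : (c + 2 * c * A + 1) * Q = c * Q + A * Q * (2 * c) + Q by move: c => c'; ring.
move: WA cQ re1; move: (A * Q * (2 * c)) (c * Q) => *; lra.
Qed.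


(** Q = w^((p + 1) / 2) / H is bounded by a power of 1 + |y|^2: at a maximum of
    Q (r - |x|^2)^(2 j) over the ball |x|^2 < r, the local bound on w and the
    lower bound on H control the maximum by a power of r. *)
Lemma log_ratio_bound : exists C, forall y,
  (p + 1) / 2 * ln (w y) - ln (H y) <= C + 2 * (c + 1) * ln (1 + sqnorm2 y).
Proof.
have p1 := p_gt1; have c0 : 0 < c := exponent_gt0 p_gt1.
have [a a0 Ha] := H_lower_bound p_gt1 w_gt0 H_gt0 H_jet H_eq H_cont.
set m := 2 * (c + 1) in Ha *; have m0 : 0 < m by rewrite /m; lra.
pose G x := (p + 1) / 2 * ln (w x) - ln (H x).
have [j jP] : exists j : nat, (p + 1) / 2 * c <= j%:R.
  exists (Num.truncn ((p + 1) / 2 * c)).+1; exact/ltW/truncnS_gt.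
have j0 : 0 < j%:R :> R by apply: lt_le_trans jP; rewrite mulr_gt0//; lra.
(* with this exponent the powers of r - |y|^2 cancel at the maximum point y *)
pose k := (2 * j)%N.
have kE : k%:R = 2 * j%:R :> R by rewrite natrM.
pose C2 := c + 2 * c * (4 * k%:R + 2 * n%:R * k%:R + 8 * c * k%:R ^+ 2) + 1.
have C21 : 1 <= C2.
  rewrite /C2 lerDr addr_ge0 ?(ltW c0)// mulr_ge0//; first lra.
  by rewrite !addr_ge0// !mulr_ge0 ?sqr_ge0 ?(ltW c0).
exists (j%:R * ln C2 + 2 * j%:R * ln 2 - ln a + m * ln 2) => y0.
set b0 := 1 + sqnorm2 y0; have b01 : 1 <= b0 by rewrite lerDl sqnorm2_ge0.
(* r is comparable to r - |y0|^2 = 1 + |y0|^2 *)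
pose r := 1 + 2 * sqnorm2 y0.
have r1 : 1 <= r by rewrite lerDl mulr_ge0// sqnorm2_ge0.
have rb : r <= 2 * b0 by rewrite /r /b0; lra.
have cG : continuous G.
  by apply: contD; [apply: contZ|apply: contN]; apply: cont_comp => // y; apply: continuous_ln.
have cF : continuous (fun x => expR (G x) * (r - sqnorm2 x) ^+ k).
  apply: contM.
    by apply: (@cont_comp R V (@expR R)) => // y; exact: continuous_expR.
  apply: (@cont_comp R V (fun t => (r - t) ^+ k)).
    exact: sqnorm2_cont.
  move=> y; apply: (@continuous_comp _ _ _ (fun t => r - t) (fun t => t ^+ k)).
    by apply: continuousB; [exact: cst_continuous|exact: cvg_id].
  exact: exprn_continuous.
have [y yr ymax] := sqnorm2_le_max (le_trans ler01 r1) cF.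
have y0r : sqnorm2 y0 < r by rewrite /r; have := sqnorm2_ge0 y0; lra.
have {}yr : sqnorm2 y < r.
  rewrite lt_neqAle yr andbT; apply/eqP => yr'.
  have := ymax y0 (ltW y0r); rewrite yr' subrr expr0n.
  have -> : (k == 0)%N = false.
    by apply/negbTE; move: j0; rewrite ltr0n /k; case: (j).
  by rewrite mulr0 leNgt mulr_gt0 ?expR_gt0 ?exprn_gt0// subr_gt0.
have ymax' x : sqnorm2 x < r ->
    G x + k%:R * ln (r - sqnorm2 x) <= G y + k%:R * ln (r - sqnorm2 y).
  move=> xr; have := ymax x (ltW xr).
  have F z : sqnorm2 z < r -> expR (G z) * (r - sqnorm2 z) ^+ k =
      expR (G z + k%:R * ln (r - sqnorm2 z)).
    by move=> zr; rewrite [RHS]expRD expRM_natl lnK// posrE subr_gt0.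
  by rewrite !F// ler_expR.
have W : w y `^ (p - 1) <= C2 * (r / (r - sqnorm2 y)) ^+ 2.
  apply: w_local_bound => //.
  have : nbhs y [set x | sqnorm2 x < r].
    by have := @sqnorm2_cont R n y [set t | t < r] (lt_nbhsl yr).
  by apply: filterS => x xr /=; have := ymax' x xr; rewrite /G; lra.
set e := r - sqnorm2 y in W *; have e0 : 0 < e by rewrite subr_gt0.
have re1 : 1 <= r / e by rewrite ler_pdivlMr// /e; have := sqnorm2_ge0 y; lra.
have re0 : 0 < r / e by exact: lt_le_trans re1.
have C20 : 0 < C2 by exact: lt_le_trans C21.
have r0 : 0 < r by exact: lt_le_trans r1.
have lw : (p - 1) * ln (w y) <= ln C2 + 2 * (ln r - ln e).
  rewrite -ln_powR -ln_div ?posrE// mulr_natl -lnXn// -lnM ?posrE ?exprn_gt0//.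
  by rewrite ler_ln ?posrE ?powR_gt0// mulr_gt0// exprn_gt0.
have l0 : 0 <= ln C2 + 2 * (ln r - ln e).
  by rewrite -ln_div ?posrE// addr_ge0 ?mulr_ge0 ?ln_ge0.
have lw' : (p + 1) / 2 * ln (w y) <= j%:R * (ln C2 + 2 * (ln r - ln e)).
  apply: (@le_trans _ _ ((p + 1) / 2 * c * (ln C2 + 2 * (ln r - ln e)))); last first.
    by rewrite ler_wpM2r.
  rewrite -[X in _ <= X](mulrA ((p + 1) / 2)) ler_wpM2l//; first lra.
  by rewrite mulrC ler_pdivlMr ?subr_gt0// mulrC.
have t0 := sqnorm2_ge0 y.
have lH : ln a - m * ln (1 + sqnorm2 y) <= ln (H y).
  rewrite -ler_expR expRD lnK ?posrE// [expR (ln (H y))]lnK ?posrE// -mulNr.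
  exact: Ha.
have l1 : ln (1 + sqnorm2 y) <= ln (2 * b0).
  by rewrite ler_ln ?posrE; move: yr; rewrite /r /b0; lra.
have l2 : ln r <= ln (2 * b0) by rewrite ler_ln ?posrE//; lra.
have b00 : 0 < b0 by exact: lt_le_trans b01.
have l3 : ln (2 * b0) = ln 2 + ln b0 by rewrite lnM// posrE.
have := ymax' y0 y0r; have -> : r - sqnorm2 y0 = b0 by rewrite /r /b0; ring.
rewrite -/e /G kE l3 in l1 l2 *.
have : m * ln (1 + sqnorm2 y) <= m * (ln 2 + ln b0) by rewrite ler_wpM2l// ltW.
have : j%:R * ln r <= j%:R * (ln 2 + ln b0) by rewrite ler_wpM2l// ltW.
move: lw' lH; clear.
move: ((p + 1) / 2 * ln (w y)) ((p + 1) / 2 * ln (w y0)) m (ln _) => *; lra.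
Qed.

End keller_osserman.

(** * Growth along rays *)

Section polynomial_growth.
Context {R : realType} {n : nat}.
Local Notation V := 'rV[R]_n.

Lemma ou_jet_ray (f : V -> R) y (s : R) g h d : ou_jet f (expR s *: y) g h d ->
  is_derive s 1 (fun t : R => f (expR t *: y)) d.
Proof.
move=> [_ D].
have D1 : is_derive s 1 (fun t : R => t + - s) 1.
  by apply: (der_eq (derD (der_id s) (der_cst (- s) s))); rewrite addr0.
have -> : (fun t : R => f (expR t *: y)) =
    fun t => (fun u => f (expR u *: (expR s *: y))) (t + - s).
  by apply/funext => t; rewrite scalerA -expRD subrK.
have D2 : is_derive (s + - s) 1 (fun u => f (expR u *: (expR s *: y))) d.
  by rewrite subrr.
by apply: (der_eq (@derC _ _ (fun t => t + - s) _ _ _ D2 D1)); rewrite mulr1.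
Qed.

Context (p : R) (w H : V -> R) (w1 w2 : V -> 'I_n -> R).
Local Notation c := ((p - 1)^-1).
Context (p_gt1 : 1 < p) (w_gt0 : forall y, 0 < w y) (H_gt0 : forall y, 0 < H y).
Context (w_jet : forall y, ou_jet w y (w1 y) (w2 y) (2 * H y - 2 * c * w y)).

(** Along a ray, z = w^((1 - p) / 2) satisfies z' = z - (p - 1) w^(-(p + 1) / 2) H
    in logarithmic time. If H is not too small compared to w^((p + 1) / 2), then
    z has to start above a definite value in order to stay positive. *)
Lemma log_growth (C m : R) : 0 <= m ->
  (forall y, (p + 1) / 2 * ln (w y) - ln (H y) <= C + m * ln (1 + sqnorm2 y)) ->
  exists C', forall y, p * ln (w y) - ln (H y) <= C' + 2 * m * ln (1 + sqnorm2 y).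
Proof.
move=> m0 CP; have p1 := p_gt1.
have p10 : 0 < p - 1 by rewrite subr_gt0.
have m10 : 0 < 2 * m + 1 by lra.
suff [C' C'P] : exists C', forall y,
    (p - 1) / 2 * ln (w y) <= C' + m * ln (1 + sqnorm2 y).
  exists (C + C') => y; have := CP y; have := C'P y.
  move: (ln (w y)) (ln (H y)) (ln (1 + _)) => *; lra.
exists (C - ln ((p - 1) / (2 * m + 1))) => y.
set t := sqnorm2 y; have t0 : 0 <= t := sqnorm2_ge0 y.
pose E := expR (- C - m * ln (1 + t)); have E0 : 0 < E by exact: expR_gt0.
pose A := (p - 1) / (2 * m + 1) * E.
have A0 : 0 < A by rewrite mulr_gt0// divr_gt0.
pose z s := expR (- ((p - 1) / 2) * ln (w (expR s *: y))).
have z_gt0 s : 0 < z s by exact: expR_gt0.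
pose Hw s := H (expR s *: y) / w (expR s *: y).
have dz (s : R) : is_derive s 1 z (z s * (1 - (p - 1) * Hw s)).
  have D := derC (is_derive1_ln (w_gt0 (expR s *: y))) (ou_jet_ray (w_jet (expR s *: y))).
  apply: (der_eq (derC (is_derive_expR _) (derZ (- ((p - 1) / 2)) D))).
  have w0 : w (expR s *: y) != 0 by rewrite gt_eqF.
  by rewrite /z /Hw; field; rewrite w0 gt_eqF.
have zHw s : 0 <= s -> E * expR (- (2 * m * s)) <= z s * Hw s.
  move=> s0; set x := expR s *: y.
  have -> : Hw s = expR (ln (H x) - ln (w x)).
    by rewrite expRD expRN !lnK ?posrE.
  rewrite /z -/x -!expRD ler_expR.
  have e2 : 1 <= expR (2 * s) by rewrite -[X in X <= _]expR0 ler_expR; lra.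
  have xE : sqnorm2 x = expR (2 * s) * t.
    rewrite /t /sqnorm2 mulr_sumr; apply: eq_bigr => i _.
    by rewrite !mxE exprMn -expRM_natl.
  have : ln (1 + sqnorm2 x) <= 2 * s + ln (1 + t).
    have x0 := sqnorm2_ge0 x.
    rewrite -ler_expR expRD !lnK ?posrE; [|lra|lra].
    by rewrite xE mulrDr; lra.
  move=> /(ler_wpM2l m0); have := CP x; rewrite mulrDr.
  move: (ln (w x)) (ln (H x)) (m * ln (1 + sqnorm2 x)) (m * ln (1 + t)) => *; lra.
(* A exp(- 2 m s) solves z' = z - (p - 1) E exp(- 2 m s), and P is exp(- s) times
   the difference of z and this solution *)
pose P s := expR (- s) * z s + - A * expR (- ((2 * m + 1) * s)).
pose P' s := expR (- s) * (- ((p - 1) * (z s * Hw s)))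
             + A * (2 * m + 1) * expR (- ((2 * m + 1) * s)).
have dP (s : R) : is_derive s 1 P (P' s).
  have d1 : is_derive s 1 (fun s : R => expR (- s)) (expR (- s) * -1).
    exact: (derC (is_derive_expR _) (derN (der_id s))).
  have d2 : is_derive s 1 (fun s : R => expR (- ((2 * m + 1) * s)))
      (expR (- ((2 * m + 1) * s)) * - ((2 * m + 1) * 1)).
    exact: (derC (is_derive_expR _) (derN (derZ _ (der_id s)))).
  by apply: (der_eq (derD (derM d1 (dz s)) (derZ (- A) d2))); rewrite /P'; ring.
have P'0 s : 0 <= s -> P' s <= 0.
  move=> /zHw/(ler_wpM2l (ltW p10))/(ler_wpM2l (ltW (expR_gt0 (- s)))).
  rewrite /P'; have -> : A * (2 * m + 1) = (p - 1) * E by rewrite /A; field; rewrite gt_eqF.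
  have -> : - ((2 * m + 1) * s) = - s + - (2 * m * s) by ring.
  by rewrite expRD; lra.
have AP : A <= z 0.
  rewrite leNgt; apply/negP => zA.
  have Az0 : 0 < A - z 0 by rewrite subr_gt0.
  have q1 : 1 < A / (A - z 0) by rewrite ltr_pdivlMr// mul1r; have := z_gt0 0; lra.
  (* a time at which z could no longer be positive *)
  pose s := ln (A / (A - z 0)) / (2 * m + 1).
  have s0 : 0 <= s by rewrite divr_ge0 ?ln_ge0 ?ltW.
  have := nincr_of_der (fun x _ => dP x) P'0 s0.
  have ms : - ((2 * m + 1) * s) = ln ((A - z 0) / A).
    by rewrite /s mulrC divfK ?gt_eqF// -lnV ?posrE ?divr_gt0// invf_div.
  rewrite /P ms lnK ?posrE ?divr_gt0// mulr0 oppr0 expR0 mul1r mulr1.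
  have -> : - A * ((A - z 0) / A) = z 0 - A by field; rewrite gt_eqF.
  by rewrite gerDr leNgt mulr_gt0 ?expR_gt0.
have lA : ln A = ln ((p - 1) / (2 * m + 1)) + (- C - m * ln (1 + t)).
  by rewrite /A lnM ?posrE ?divr_gt0// expRK.
have : ln A <= ln (z 0) by rewrite ler_ln ?posrE.
rewrite lA /z expR0 scale1r expRK; lra.
Qed.

End polynomial_growth.

(** * Barriers for the Liouville theorem *)

Section liouville.
Context {R : realType} {n : nat}.
Local Notation V := 'rV[R]_n.

Lemma dot_ge (y0 y : V) : - (sqnorm2 y0 / 4) <= dot y (y - y0).
Proof.
rewrite /dot /sqnorm2 mulr_suml -sumrN; apply: ler_sum => i _; rewrite !mxE.
rewrite -subr_ge0; have -> : y 0 i * (y 0 i - y0 0 i) - - (y0 0 i ^+ 2 / 4) =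
  (y 0 i - y0 0 i / 2) ^+ 2 by field.
exact: sqr_ge0.
Qed.

Lemma sqnorm2B_le (y0 y : V) : sqnorm2 (y - y0) <= 2 * sqnorm2 y + 2 * sqnorm2 y0.
Proof.
rewrite /sqnorm2 !mulr_sumr -big_split/=; apply: ler_sum => i _; rewrite !mxE.
by have := sqr_ge0 (y 0 i + y0 0 i); nra.
Qed.

(** If a Gaussian bump is narrow, its positive second derivative in the radial
    direction dominates the other terms of L away from the centre. *)
Lemma gaussian_bump (y0 : V) (r T : R) : 0 < r -> exists (b : V -> R) (m B : R),
  [/\ continuous b, forall y, 0 < b y <= 1, 0 < m, 0 <= B &
   forall y, exists g h d, [/\ ou_jet b y g h d, - B <= ou h d,
     r <= sqnorm2 (y - y0) -> 0 < ou h d &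
     r <= sqnorm2 (y - y0) -> sqnorm2 y <= T -> m <= ou h d]].
Proof.
move=> r0; pose N := 2 * n%:R + sqnorm2 y0 / 4.
have N0 : 0 <= N by rewrite addr_ge0 ?mulr_ge0 ?divr_ge0 ?sqnorm2_ge0.
(* outside the ball of squared radius r, 4 al |z|^2 is at least N + 1 *)
pose al := (N + 1) / (4 * r); have al0 : 0 < al by rewrite divr_gt0//; lra.
have alr : 4 * al * r = N + 1 by rewrite /al; field; rewrite gt_eqF.
pose Z := 2 * T + 2 * sqnorm2 y0.
exists (fun x => expR (- al * sqnorm2 (x - y0))), (al * expR (- al * Z)), (al * N).
split.
- apply: (@cont_comp R V (@expR R)) => [|y]; last exact: continuous_expR.
  by apply: contZ; exact: sqnorm2_continuous.
- move=> y; rewrite expR_gt0/= -[X in _ <= X]expR0 ler_expR.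
  by rewrite mulNr oppr_le0 mulr_ge0 ?sqnorm2_ge0// ltW.
- by rewrite mulr_gt0 ?expR_gt0.
- by rewrite mulr_ge0// ltW.
move=> y; set z := sqnorm2 (y - y0); have z0 : 0 <= z := sqnorm2_ge0 _.
have J : jet2 (fun t => expR (- al * t)) z (- al * expR (- al * z))
    (al ^+ 2 * expR (- al * z)).
  have J1 : jet2 (fun t => - al * t) z (- al) 0.
    rewrite (_ : (fun t => - al * t) = fun t => - al * t + 0 * t ^+ 2).
      by apply: (jet2_eq (jet2_quadratic (- al) 0 z)); ring.
    by apply/funext => t; ring.
  by apply: (jet2_eq (jet2_comp J1 (jet2_expR _))); ring.
have [g [h [d [Jb [_ _ E]]]]] := ou_jet_radial J.
exists g, h, d; set e := expR (- al * z) in J E; have e0 : 0 < e := expR_gt0 _.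
have e1 : e <= 1.
  by rewrite -[X in _ <= X]expR0 ler_expR mulNr oppr_le0 mulr_ge0// ltW.
have E' : ou h d = al * e * (4 * al * z - 2 * n%:R + dot y (y - y0)).
  by rewrite E -/z; ring.
have lo : al * e * (4 * al * z - N) <= ou h d.
  rewrite E' ler_wpM2l ?(mulr_ge0 (ltW al0) (ltW e0))//.
  by have := dot_ge y0 y; rewrite /N; lra.
have lo' : r <= z -> al * e <= ou h d.
  move=> rz; apply: le_trans lo; rewrite ler_peMr ?(mulr_ge0 (ltW al0) (ltW e0))//.
  have : 4 * al * r <= 4 * al * z.
    by rewrite ler_wpM2l//; apply: mulr_ge0 => //; exact: ltW.
  lra.
split=> //.
- apply: le_trans lo; have q : 0 <= al * e * (4 * al * z).
    apply: mulr_ge0; apply: mulr_ge0 => //; [exact: ltW|exact: ltW|].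
    by apply: mulr_ge0 => //; exact: ltW.
  have : al * e * N <= al * N by rewrite -mulrA ler_wpM2l ?(ltW al0)// ler_piMl.
  by rewrite mulrBr; lra.
- by move=> /lo'; apply: lt_le_trans; rewrite mulr_gt0.
- move=> /lo' el yT; apply: le_trans el; rewrite ler_wpM2l ?(ltW al0)// ler_expR.
  rewrite !mulNr lerN2 ler_wpM2l ?(ltW al0)//.
  by have := sqnorm2B_le y0 y; rewrite /Z -/z; lra.
Qed.

Lemma ou_bracket_le (k : R) : 1 <= k -> exists T B, [/\ 0 <= T, 0 <= B &
  forall y : V, exists g h d, [/\ ou_jet (bracket k) y g h d, ou h d <= B &
    T <= sqnorm2 y -> ou h d <= 0]].
Proof.
move=> k1; have N0 : 0 <= n%:R :> R := ler0n _ _.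
pose T : R := 2 * n%:R + 4 * (k - 1); have T0 : 0 <= T by rewrite /T; lra.
exists T, (expR (k * ln (1 + T)) * (k * T)); split=> //.
  by rewrite !mulr_ge0 ?expR_ge0//; lra.
move=> y; have [g [h [d [J E]]]] := ou_jet_bracket k y.
exists g, h, d; set t := sqnorm2 y in E *; have t0 : 0 <= t := sqnorm2_ge0 y.
have up : ou h d <= bracket k y * (k * (T - t) / (1 + t)).
  rewrite E ler_wpM2l ?(ltW (bracket_gt0 _ _))//.
  have -> : k * (T - t) / (1 + t) = 4 * k * (k - 1) / (1 + t) +
      k * (2 * n%:R - t) / (1 + t).
    by rewrite -mulrDl; congr (_ / _); rewrite /T; ring.
  have t1 : 0 < 1 + t by lra.
  rewrite lerD2r ler_pdivrMr ?exprn_gt0//.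
  have -> : 4 * k * (k - 1) / (1 + t) * (1 + t) ^+ 2 = 4 * k * (k - 1) * (1 + t).
    by field; lra.
  by rewrite ler_wpM2l ?mulr_ge0//; lra.
split=> //; last first.
  move=> Tt; apply: (le_trans up); rewrite mulr_ge0_le0 ?(ltW (bracket_gt0 _ _))//.
  rewrite mulr_le0_ge0//; first by rewrite mulr_ge0_le0//; lra.
  by rewrite invr_ge0; lra.
apply: (le_trans up); have [Tt|tT] := leP T t.
  apply: (@le_trans _ _ 0); last by rewrite !mulr_ge0 ?expR_ge0//; lra.
  rewrite mulr_ge0_le0 ?(ltW (bracket_gt0 _ _))// mulr_le0_ge0//.
    by rewrite mulr_ge0_le0//; lra.
  by rewrite invr_ge0; lra.
apply: ler_pM; rewrite ?(ltW (bracket_gt0 _ _))//.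
- by rewrite !mulr_ge0 ?invr_ge0//; lra.
- rewrite ler_expR ler_wpM2l//; first lra.
  by rewrite ler_ln ?posrE//; rewrite -/t; lra.
- rewrite ler_pdivrMr; last lra.
  by have : 0 <= k * T * t by [rewrite !mulr_ge0//; lra]; nra.
Qed.

(** Combining the two: a growing function whose Ornstein-Uhlenbeck Laplacian is
    negative except near a prescribed point, where it is as small as desired.
    Such functions exist since the Ornstein-Uhlenbeck process is recurrent. *)
Lemma recurrence_barrier (y0 : V) (k r eta : R) : 1 <= k -> 0 < r -> 0 < eta ->
  exists (Phi : V -> R) (e : R), [/\ continuous Phi, 0 < e,
    forall y, 2^-1 <= Phi y, forall y, e * bracket k y <= Phi y &
    forall y, exists g h d, [/\ ou_jet Phi y g h d, ou h d < eta &
      r <= sqnorm2 (y - y0) -> ou h d < 0]].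
Proof.
move=> k1 r0 eta0; have [T [B [T0 B0 HB]]] := ou_bracket_le k1.
have [b [m [B' [cb b01 m0 B'0 Hb]]]] := gaussian_bump y0 T r0.
(* near y0 the bump costs at most eta / 2 *)
pose e := Num.min 2^-1 (eta / (2 * (B' + 1))).
have e0 : 0 < e by rewrite lt_min invr_gt0 ltr0n/= divr_gt0//; lra.
have e2 : e <= 2^-1 by rewrite ge_min lexx.
have eB' : e * B' <= eta / 2.
  have : e <= eta / (2 * (B' + 1)) by rewrite ge_min lexx orbT.
  rewrite ler_pdivlMr; last lra.
  lra.
(* away from y0 the growing term costs less than the bump gains, and near y0 it
   costs less than eta / 2 *)
pose e' := Num.min (e * m) (eta / 2) / (B + 1).
have e'0 : 0 < e' by rewrite divr_gt0 ?lt_min ?mulr_gt0 ?divr_gt0//; lra.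
have e'B : e' * B < e * m /\ e' * B < eta / 2.
  have E : e' * (B + 1) = Num.min (e * m) (eta / 2) by rewrite divfK// gt_eqF//; lra.
  have : Num.min (e * m) (eta / 2) <= e * m by rewrite ge_min lexx.
  have : Num.min (e * m) (eta / 2) <= eta / 2 by rewrite ge_min lexx orbT.
  by rewrite -E mulrDr; lra.
pose Phi x := 1 + (e' * bracket k x + - (e * b x)).
have eb y : e * b y <= 2^-1.
  by have /andP[b0 b1] := b01 y; rewrite (le_trans _ e2)// ler_piMr// ltW.
exists Phi, e'; split=> //.
- apply: contD; first by move=> y; exact: cst_continuous.
  by apply: contD; [apply: contZ; exact: bracket_continuous|apply/contN/contZ].
- move=> y; rewrite /Phi; have := eb y.
  by have := mulr_gt0 e'0 (bracket_gt0 k y); lra.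
- by move=> y; rewrite /Phi; have := eb y; lra.
move=> y; have [g [h [d [J u u0]]]] := HB y.
have [g' [h' [d' [J' l l0 lm]]]] := Hb y.
have := ou_jetD (ou_jet_cst 1 y) (ou_jetD (ou_jetZ e' J) (ou_jetN (ou_jetZ e J'))).
move=> K; eexists; eexists; eexists; split; first exact: K.
- rewrite !ouD ouN !ouZ (_ : ou _ 0 = 0); last by rewrite /ou big1//; lra.
  have := ler_wpM2l (ltW e'0) u; have := ler_wpM2l (ltW e0) l; lra.
- move=> ry; rewrite !ouD ouN !ouZ (_ : ou _ 0 = 0); last by rewrite /ou big1//; lra.
  have [yT|yT] := leP (sqnorm2 y) T.
    have := ler_wpM2l (ltW e'0) u; have := ler_wpM2l (ltW e0) (lm ry yT); lra.
  have := ler_wpM2l (ltW e'0) (u0 (ltW yT)); have := mulr_gt0 e0 (l0 ry); lra.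
Qed.

End liouville.

(** * Rigidity of the profile *)

Section rigidity.
Context {R : realType} {n : nat}.
Local Notation V := 'rV[R]_n.
Context (p : R) (w H DH : V -> R) (w1 w2 H1 H2 : V -> 'I_n -> R).
Local Notation c := ((p - 1)^-1).
Context (p_gt1 : 1 < p) (w_gt0 : forall y, 0 < w y) (H_gt0 : forall y, 0 < H y).
Context (w_jet : forall y, ou_jet w y (w1 y) (w2 y) (2 * H y - 2 * c * w y)).
Context (H_jet : forall y, ou_jet H y (H1 y) (H2 y) (DH y)).
Context (w_eq : forall y, \sum_(i < n) w2 y i + w y `^ p = H y).
Context (H_eq : forall y, ou (H2 y) (DH y) - (c + 1) * H y
                          + p * w y `^ (p - 1) * H y = 0).
Context (w_cont : continuous w) (H_cont : continuous H).
Context (w1_cont : forall i, continuous (w1 ^~ i)).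

(** For beta = p the zeroth order term disappears. The factor (p - 1) / 2 of
    ln Phi is what lets the gradient terms of Phi be absorbed while a positive
    multiple of |grad ln w|^2 is kept. *)
Lemma gradient_max_principle (Phi : V -> R) y g h d : ou_jet Phi y g h d -> 0 < Phi y ->
  (\forall x \near y, p * ln (w x) - ln (H x) - (p - 1) / 2 * ln (Phi x) <=
                      p * ln (w y) - ln (H y) - (p - 1) / 2 * ln (Phi y)) ->
  2 * p / (p + 1) * Phi y * (\sum_(i < n) grad_ln w w1 y i ^+ 2) <= ou h d.
Proof.
move=> J Phi0 ymax; have p1 := p_gt1.
have K := ou_jetZ ((p - 1) / 2) (ou_jet_comp J (jet2_ln Phi0)).
have := log_max_principle p_gt1 w_gt0 H_gt0 w_jet H_jet w_eq H_eq K ymax.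
rewrite subrr mul0r addr0; set S := \sum_(i < n) _.
rewrite ouZ /ou big_split/= -!mulr_sumr.
set f := Phi y in Phi0 *; have f0 : f != 0 by rewrite gt_eqF.
set G := \sum_(i < n) g i ^+ 2; set L := \sum_(i < n) h i => upS.
have p1' : p - 1 != 0 by rewrite gt_eqF// subr_gt0.
have p2' : p + 1 != 0 by rewrite gt_eqF//; lra.
have lowS : p * (p - 1) / (p + 1) * (\sum_(i < n) grad_ln w w1 y i ^+ 2)
    - (p - 1) / 2 * f ^- 2 * G <= S.
  rewrite /G /S !mulr_sumr -sumrB; apply: ler_sum => i _.
  set X := grad_ln w w1 y i; set a := g i; rewrite -subr_ge0.
  have -> : (p * X - (p - 1) / 2 * (f^-1 * a)) ^+ 2 - p * X ^+ 2 -
      (p * (p - 1) / (p + 1) * X ^+ 2 - (p - 1) / 2 * f ^- 2 * a ^+ 2) =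
      (p + 1) / (p - 1) *
        ((p - 1) / 2 * (f^-1 * a) - p * (p - 1) / (p + 1) * X) ^+ 2.
    by field; rewrite p1' p2' f0.
  by rewrite mulr_ge0 ?sqr_ge0// divr_ge0//; lra.
have q0 : 0 < 2 * f / (p - 1) by rewrite divr_gt0 ?mulr_gt0// subr_gt0.
have := le_trans lowS upS.
rewrite -(ler_pM2l q0); set X := \sum_(i < n) _.
have -> : 2 * f / (p - 1) * (p * (p - 1) / (p + 1) * X - (p - 1) / 2 * f ^- 2 * G) =
  2 * p / (p + 1) * f * X - f^-1 * G by field; rewrite p1' p2' f0.
have -> : 2 * f / (p - 1) * ((p - 1) / 2 * (- f ^- 2 * G + f^-1 * L - f^-1 * d / 2)) =
  L - d / 2 - f^-1 * G by field; rewrite p1' f0.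
by rewrite lerD2r.
Qed.

(** (w^p / H)^(2 / (p - 1)) is a subsolution, strictly so where grad w does not
    vanish. Comparing it with a barrier that is almost constant, grows faster and
    is a strict supersolution away from y0 shows that grad w = 0 at y0. *)
Lemma grad_zero (C M : R) : 0 <= M ->
  (forall y, p * ln (w y) - ln (H y) <= C + M * ln (1 + sqnorm2 y)) ->
  forall y i, w1 y i = 0.
Proof.
move=> M0 CM y0 i0; have p1 := p_gt1.
pose S y := \sum_(i < n) grad_ln w w1 y i ^+ 2.
have S_ge0 y : 0 <= S y by apply: sumr_ge0 => i _; exact: sqr_ge0.
suff : S y0 <= 0.
  move=> S0; have : grad_ln w w1 y0 i0 ^+ 2 <= 0.
    apply: le_trans S0; rewrite /S (bigD1 i0)//= lerDl.
    by apply: sumr_ge0 => i _; exact: sqr_ge0.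
  rewrite real_exprn_even_le0 ?num_real//= mulf_eq0 invr_eq0.
  by rewrite (gt_eqF (w_gt0 y0)) => /eqP.
rewrite leNgt; apply/negP => S0.
have cS : continuous S.
  apply: (@continuous_big R _ +%R 0 xpredT _ _ _ (fun i y => grad_ln w w1 y i ^+ 2)).
    by move=> z; exact: add_continuous.
  move=> i _; apply: (@cont_comp R V (fun t => t ^+ 2)); last first.
    by move=> y; exact: exprn_continuous.
  apply: contM; last exact: w1_cont.
  apply: (@cont_comp R V GRing.inv) => // y.
  by apply: inv_continuous; rewrite gt_eqF.
have [r r0 Sr] : exists2 r, 0 < r &
    forall y, sqnorm2 (y - y0) < r -> S y0 / 2 < S y.
  have : nbhs y0 [set y | S y0 / 2 < S y].
    by apply: (cS y0 [set t | S y0 / 2 < t]); apply: lt_nbhsr; rewrite /=; lra.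
  move=> /nbhs_ballP[e /= e0 He]; exists (e ^+ 2); first exact: exprn_gt0.
  move=> y ye; apply: He; split=> // i j; rewrite ord1.
  rewrite /ball/= -(ltr_pXn2r (n:=2))// ?nnegrE ?ltW//.
  rewrite distrC real_normK ?num_real//; apply: le_lt_trans ye.
  rewrite /sqnorm2 (bigD1 j)//= !mxE lerDl.
  by apply: sumr_ge0 => k _; exact: sqr_ge0.
pose s := 2 / (p - 1); have s0 : 0 < s by rewrite divr_gt0// subr_gt0.
have sp : (p - 1) / 2 * s = 1 by rewrite /s; field; lra.
(* the barrier grows faster than exp(s G), whose growth exponent is s M *)
pose k := s * M + 1.
have k1 : 1 <= k by rewrite lerDr mulr_ge0// ltW.
pose q := 2 * p / (p + 1); have q0 : 0 < q by rewrite divr_gt0//; lra.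
have [|Phi [e [cPhi e0 Phi2 Phie JPhi]]] :=
    @recurrence_barrier R n y0 k r (q * 2^-1 * (S y0 / 2)) k1 r0.
  by apply: mulr_gt0; [apply: mulr_gt0 => //; rewrite invr_gt0|exact: divr_gt0].
have Phi0 y : 0 < Phi y by apply: lt_le_trans (Phi2 y).
pose F x := p * ln (w x) - ln (H x) - (p - 1) / 2 * ln (Phi x).
have cF : continuous F.
  apply: contD; [apply: contD; [apply: contZ|apply: contN]|apply/contN/contZ];
    apply: cont_comp => // y; exact: continuous_ln.
have far x : expR (s * (C - F 0) - ln e) < sqnorm2 x -> F x < F 0.
  move=> xr; set l := ln (1 + sqnorm2 x).
  have l0 : s * (C - F 0) - ln e < l.
    have x0 := sqnorm2_ge0 x.
    by rewrite -ltr_expR lnK ?posrE; lra.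
  have lPhi : ln e + k * l <= ln (Phi x).
    rewrite -ler_expR expRD !lnK ?posrE//; exact: Phie.
  have := CM x; rewrite -/l /F => CMx.
  have p20 : 0 < (p - 1) / 2 by lra.
  have := ler_wpM2l (ltW p20) lPhi.
  have : (p - 1) / 2 * (s * (C - F 0) - ln e) < (p - 1) / 2 * l by rewrite ltr_pM2l.
  have -> : (p - 1) / 2 * (ln e + k * l) =
      (p - 1) / 2 * ln e + (p - 1) / 2 * s * (M * l) + (p - 1) / 2 * l.
    by rewrite /k; ring.
  rewrite mulrBr (mulrA _ s) sp !mul1r -/(F 0).
  move: (F 0) (M * l) ((p - 1) / 2 * ln e) ((p - 1) / 2 * l) ((p - 1) / 2 * ln (Phi x)) CMx.
  by move=> *; lra.
have [y ymax] := max_attained cF far.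
have [g [h [d [J up neg]]]] := JPhi y.
have nmax : \forall x \near y, F x <= F y by apply: filterE => x; exact: ymax.
have := gradient_max_principle J (Phi0 y) nmax.
rewrite -/(S y) -/q => K.
have [yr|ry] := ltP (sqnorm2 (y - y0)) r; last first.
  have := le_lt_trans K (neg ry).
  rewrite ltNge; case/negP; apply: mulr_ge0 => //; apply: mulr_ge0; exact: ltW.
have := le_lt_trans K up; rewrite ltNge => /negP; apply.
apply: ler_pM.
- by apply: mulr_ge0; [exact: ltW|rewrite invr_ge0].
- exact/ltW/divr_gt0.
- by rewrite ler_pM2l.
- exact/ltW/Sr.
Qed.

(** As the gradient vanishes, w is constant and the equations reduce to
    c w = H = w^p. *)
Lemma profile_constant y : w y = c `^ c.
Proof.
have p1 := p_gt1; have c0 : 0 < c := exponent_gt0 p_gt1.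
have [C CP] := log_ratio_bound p_gt1 w_gt0 H_gt0 w_jet H_jet w_eq H_eq w_cont H_cont.
have m0 : 0 <= 2 * (c + 1) by lra.
have [C' C'P] := log_growth p_gt1 w_gt0 H_gt0 w_jet m0 CP.
have w10 := grad_zero (mulr_ge0 (ler0n R 2) m0) C'P.
have wline x i t : w (x + t *: delta_mx 0 i) = w x.
  pose f t := w (x + t *: delta_mx 0 i).
  have df t' : is_derive (t' : R) 1 f 0.
    have [Ji _] := w_jet (x + t' *: delta_mx 0 i).
    have := jet2_der (Ji i); rewrite w10 => D.
    have D1 : is_derive t' 1 (fun u : R => u + - t') 1.
      by apply: (der_eq (derD (der_id _) (der_cst (- t') _))); rewrite addr0.
    have D2 : is_derive (t' + - t') 1
        (fun t => w (x + t' *: delta_mx 0 i + t *: delta_mx 0 i)) 0.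
      by rewrite subrr.
    have := @derC _ _ (fun u => u + - t') _ _ _ D2 D1; rewrite mul0r.
    congr (is_derive _ _ _ _); apply/funext => u.
    by rewrite /f -addrA -scalerDl subrKC.
  by have := @is_derive_0_is_cst R f t 0 df; rewrite /f scale0r addr0.
have wC x : w x = w 0.
  have -> : x = \sum_(i <- enum 'I_n) x 0 i *: delta_mx 0 i.
    by rewrite big_enum {1}(row_sum_delta x).
  elim: (enum 'I_n) => [|i s IH]; first by rewrite big_nil.
  by rewrite big_cons addrC wline.
have [Ji Jr] := w_jet y.
have wH : H y = c * w y.
  have : is_derive (0 : R) 1 (fun t : R => w (expR t *: y)) 0.
    rewrite (_ : (fun _ => _) = fun=> w 0); first exact: der_cst.
    by apply/funext => t; exact: wC.
  by move=> /(der_uniq Jr); lra.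
have w20 i : w2 y i = 0.
  have mx (f : R -> R) a b : jet2 f 0 a b -> (forall t, f t = f 0) -> b <= 0.
    move=> J fc; apply: (jet2_max J _).2.
    by apply: filterE => t; rewrite fc.
  apply/eqP; rewrite eq_le (mx _ _ _ (Ji i)) /=; last by move=> t; rewrite !wline.
  rewrite -oppr_le0 (mx _ _ _ (jet2N (Ji i)))// => t; by rewrite !wline.
have := w_eq y; rewrite big1 // add0r wH (powR_pred p w_gt0) [w y * _]mulrC.
move=> /(mulIf (negbT (gt_eqF (w_gt0 y)))) E.
rewrite -{1}E -powRrM mulfV ?powRr1 ?ltW//.
by rewrite gt_eqF// subr_gt0.
Qed.

End rigidity.

(** * Symmetry of second derivatives *)

Section smooth_functions.
Context {R : realType} {V : normedModType R}.
Implicit Types (A : set V) (f g : V -> R) (z v a b : V).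

Lemma smooth_cont A f z : smooth_on A f -> A z -> {for z, continuous f}.
Proof. by move=> fs Az; apply: (fs 0%N); rewrite inE. Qed.

Lemma smooth_derivable A f z v : smooth_on A f -> A z -> derivable f z v.
Proof. by move=> fs Az; have [_ /(_ v)[+ _]] := fs 1%N; apply; rewrite inE. Qed.

Lemma smooth_derive A f v : smooth_on A f -> smooth_on A ('D_v f).
Proof. by move=> fs k; have [_ /(_ v)[_]] := fs k.+1. Qed.

Lemma line_der f z v (s d : R) : is_derive (z + s *: v) v f d ->
  is_derive s 1 (fun t : R => f (z + t *: v)) d.
Proof.
move=> [df <-].
have E : (fun h : R => h^-1 *: (f (z + (h *: (1 : R) + s) *: v) - f (z + s *: v))) =
    (fun h : R => h^-1 *: (f (h *: v + (z + s *: v)) - f (z + s *: v))).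
  apply/funext => h; congr (_ *: (f _ - _)).
  by rewrite [h *: 1]mulr1 scalerDl addrCA.
by split; rewrite /derivable /derive/= E.
Qed.

Lemma line_near A z v : open A -> A z -> \forall t \near (0 : R), A (z + t *: v).
Proof.
move=> oA Az; have c : {for (0 : R), continuous (fun t : R => z + t *: v)}.
  move=> B; apply: (@cvgD _ _ _ _ _ (fun=> z)); first exact: cvg_cst.
  by apply: cvgZr_tmp; exact: cvg_id.
apply: (c A); rewrite scale0r addr0; exact: open_nbhs_nbhs.
Qed.

Lemma smooth_line_der A f z v (s : R) : smooth_on A f -> A (z + s *: v) ->
  is_derive s 1 (fun t : R => f (z + t *: v)) ('D_v f (z + s *: v)).
Proof. by move=> fs Az; apply: line_der; apply: derivableP; exact: smooth_derivable fs Az. Qed.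

Lemma smooth_jet2 A f z v : open A -> smooth_on A f -> A z ->
  jet2 (fun t : R => f (z + t *: v)) 0 ('D_v f z) ('D_v ('D_v f) z).
Proof.
move=> oA fs Az; exists (fun t => 'D_v f (z + t *: v)).
  have := line_near v oA Az; apply: filterS => t; exact: smooth_line_der.
have z0 : z + (0 : R) *: v = z by rewrite scale0r addr0.
have := @smooth_line_der A ('D_v f) z v 0 (smooth_derive v fs).
by rewrite z0 => /(_ Az).
Qed.

(** Apply the mean value theorem in direction a to the difference in direction b,
    then in direction b to the derivative in direction a. *)
Lemma second_difference A f z a b (h : R) : smooth_on A f -> 0 < h ->
  (forall s t, 0 <= s <= h -> 0 <= t <= h -> A (z + s *: a + t *: b)) ->
  exists s t, [/\ 0 <= s <= h, 0 <= t <= h &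
    f (z + h *: a + h *: b) - f (z + h *: a) - f (z + h *: b) + f z =
    'D_b ('D_a f) (z + s *: a + t *: b) * h ^+ 2].
Proof.
move=> fs h0 box.
have h0' : 0 <= h <= h by rewrite lexx ltW.
have z0' : 0 <= (0 : R) <= h by rewrite lexx ltW.
pose F s := f (z + h *: b + s *: a) - f (z + s *: a).
have dF s : 0 <= s <= h ->
    is_derive s 1 F ('D_a f (z + h *: b + s *: a) - 'D_a f (z + s *: a)).
  move=> sh; apply: derD; [|apply: derN]; apply: smooth_line_der => //.
    by rewrite addrAC; exact: box.
  by have := box s 0 sh z0'; rewrite scale0r addr0.
pose F' s := 'D_a f (z + h *: b + s *: a) - 'D_a f (z + s *: a).
have [||s] := @MVT _ F F' 0 h h0.
- by move=> s; rewrite in_itv/= => /andP[s0 sh]; apply: dF; rewrite !ltW.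
- by apply: derivable_within_continuous => s; rewrite in_itv/= => /dF[].
rewrite in_itv/= subr0 => /andP[s0 sh] EF.
have sh' : 0 <= s <= h by rewrite !ltW.
pose G t := 'D_a f (z + s *: a + t *: b).
have dG t : 0 <= t <= h -> is_derive t 1 G ('D_b ('D_a f) (z + s *: a + t *: b)).
  move=> th; apply: (@smooth_line_der A); first exact: smooth_derive.
  exact: box.
pose G' t := 'D_b ('D_a f) (z + s *: a + t *: b).
have [||t] := @MVT _ G G' 0 h h0.
- by move=> t; rewrite in_itv/= => /andP[t0 th]; apply: dG; rewrite !ltW.
- by apply: derivable_within_continuous => t; rewrite in_itv/= => /dG[].
rewrite in_itv/= subr0 => /andP[t0 th] EG.
exists s, t; split; rewrite ?ltW// expr2 mulrA -/(G' t) -EG.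
have -> : G h - G 0 = F' s by rewrite /G /F' scale0r addr0 addrAC.
rewrite -EF /F scale0r !addr0 [z + h *: b + h *: a]addrAC; ring.
Qed.

Lemma eq_of_near_values (phi psi : V -> R) z :
  {for z, continuous phi} -> {for z, continuous psi} ->
  (forall d : R, 0 < d -> exists x y,
    [/\ `|z - x| < d, `|z - y| < d & phi x = psi y]) -> phi z = psi z.
Proof.
move=> cphi cpsi near_eq.
apply/eqP; rewrite -subr_eq0 -normr_le0; apply/ler_addgt0Pr => e e0; rewrite add0r.
have e2 : 0 < e / 2 by rewrite divr_gt0.
have n1 : \forall x \near z, `|phi z - phi x| < e / 2.
  by move/cvgrPdist_lt : cphi; apply.
have n2 : \forall x \near z, `|psi z - psi x| < e / 2.
  by move/cvgrPdist_lt : cpsi; apply.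
have [d d0 Hd] := (nbhs_normP z _).1 (filterI n1 n2).
have [x [y [xd yd E]]] := near_eq d d0.
have [X1 _] := Hd x xd; have [_] := Hd y yd; rewrite -E => X2.
have -> : phi z - psi z = (phi z - phi x) - (psi z - phi x) by ring.
by rewrite (le_trans (ler_normB _ _))//; rewrite /= in X1; lra.
Qed.

(** Symmetry of second derivatives: both mixed derivatives are limits of the
    same second difference quotients. *)
Lemma derive_comm A f z a b : open A -> smooth_on A f -> A z ->
  'D_a ('D_b f) z = 'D_b ('D_a f) z.
Proof.
move=> oA fs Az.
apply: (@eq_of_near_values ('D_a ('D_b f)) ('D_b ('D_a f)) z) => [||e e0].
- exact: (smooth_cont (smooth_derive _ (smooth_derive _ fs)) Az).
- exact: (smooth_cont (smooth_derive _ (smooth_derive _ fs)) Az).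
have [d0 /= d00 Hd0] := (nbhs_normP z A).1 (open_nbhs_nbhs (conj oA Az)).
pose d := Num.min d0 e; have d_gt0 : 0 < d by rewrite lt_min d00.
pose N := `|a| + `|b| + 1; have N0 : 0 < N by rewrite ltr_wpDl// addr_ge0.
(* the parallelogram with sides h a and h b stays within distance d of z *)
pose h := d / (2 * N); have h0 : 0 < h by rewrite divr_gt0// mulr_gt0.
have box s t : 0 <= s <= h -> 0 <= t <= h -> `|z - (z + s *: a + t *: b)| < d.
  move=> /andP[s0 sh] /andP[t0 th]; rewrite opprD addrA opprD addrA subrr add0r.
  rewrite -opprD normrN (le_lt_trans (ler_normD _ _))// !normrZ !ger0_norm//.
  have : s * `|a| <= h * `|a| by rewrite ler_wpM2r.
  have : t * `|b| <= h * `|b| by rewrite ler_wpM2r.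
  have : h * (`|a| + `|b| + 1) = d / 2 by rewrite -/N /h; field; rewrite gt_eqF.
  rewrite !mulrDr; lra.
have dA x : `|z - x| < d -> A x.
  by rewrite lt_min => /andP[xd _]; exact: Hd0.
have de x : `|z - x| < d -> `|z - x| < e by rewrite lt_min => /andP[].
have [|s [t [sh th E]]] := @second_difference A f z a b h fs h0.
  by move=> s t sh th; exact/dA/box.
have [|t' [s' [th' sh' E']]] := @second_difference A f z b a h fs h0.
  by move=> t' s' th' sh'; rewrite addrAC; exact/dA/box.
exists (z + s' *: a + t' *: b), (z + s *: a + t *: b).
split; [exact/de/box|exact/de/box|].
have h2 : h ^+ 2 != 0 by rewrite expf_neq0// gt_eqF.
rewrite (addrAC z (s' *: a)); apply: (mulIf h2); apply: etrans (esym E') _.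
by apply: etrans E; rewrite (addrAC z (h *: b)); ring.
Qed.

Lemma derive_comm2 A f z a b : open A -> smooth_on A f -> A z ->
  'D_a ('D_b ('D_b f)) z = 'D_b ('D_b ('D_a f)) z.
Proof.
move=> oA fs Az.
apply: etrans (@derive_comm A ('D_b f) z a b oA (smooth_derive b fs) Az) _.
apply: (@near_eq_derive _ _ _ ('D_a ('D_b f)) ('D_b ('D_a f)) z b).
apply: filterS (open_nbhs_nbhs (conj oA Az)) => y Ay.
exact: (@derive_comm A f y a b oA fs Ay).
Qed.

End smooth_functions.

(** * From the solution to the equations of its profile *)

Section self_similar_profile.
Context {R : realType} {n : nat}.
Local Notation V := 'rV[R]_n.
Context (p T : R) (a : V) (u ut utt : V -> R -> R).
Context (ui uii uti utii : 'I_n -> V -> R -> R).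
Local Notation c := ((p - 1)^-1).
Implicit Types (x y : V) (s t : R).
Local Notation th := (T / 2).
Local Notation sg := (Num.sqrt th).
Context (p_gt1 : 1 < p) (T_gt0 : 0 < T).
Context (u_jet : forall (i : 'I_n) (x : V) (t : R), 0 < t < T ->
  jet2 (fun s => u (x + s *: delta_mx 0 i) t) 0 (ui i x t) (uii i x t)).
Context (ut_jet : forall (i : 'I_n) (x : V) (t : R), 0 < t < T ->
  jet2 (fun s => ut (x + s *: delta_mx 0 i) t) 0 (uti i x t) (utii i x t)).
Context (u_t : forall (x : V) (t : R), 0 < t < T -> is_derive t 1 (u x) (ut x t)).
Context (ut_t : forall (x : V) (t : R), 0 < t < T -> is_derive t 1 (ut x) (utt x t)).
Context (u_eq : forall (x : V) (t : R), 0 < t < T ->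
  ut x t = \sum_(i < n) uii i x t + `|u x t| `^ (p - 1) * u x t).
Context (ut_eq : forall (x : V) (t : R), 0 < t < T -> 0 < u x t ->
  utt x t = \sum_(i < n) utii i x t + p * u x t `^ (p - 1) * ut x t).
Context (u_cont : continuous (u ^~ th)) (ut_cont : continuous (ut ^~ th)).
Context (ui_cont : forall i, continuous ((ui i) ^~ th)).
Context (u_ss : self_similar p T a u).
Context (u_mono : forall x, 0 < derive1 (selfsim_ext p T a u x) 0).

Lemma half_time : 0 < th < T.
Proof. by apply/andP; split; have T0 := T_gt0; lra. Qed.

Local Notation K := (th `^ c).
Local Notation w := (profile p T a u).

(** The rescaled time derivative, H = c w + (y . grad w) / 2. *)
Definition speed (y : V) : R := K * th * ut (a + sg *: y) th.
Local Notation H := speed.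

Lemma sg2 : sg ^+ 2 = th.
Proof. by rewrite sqr_sqrtr//; have T0 := T_gt0; lra. Qed.

Lemma K_gt0 : 0 < K.
Proof. by apply: powR_gt0; have T0 := T_gt0; lra. Qed.

Lemma scaled_continuous (g : V -> R) (k : R) : continuous g ->
  continuous (fun y : V => k * g (a + sg *: y)).
Proof.
move=> cg; apply: contZ.
have ca : continuous (fun y : V => a + sg *: y).
  move=> y; apply: (@continuousD _ _ _ (fun=> a) ( *:%R sg)).
    exact: cst_continuous.
  exact: scaler_continuous.
by move=> y; apply: continuous_comp; [exact: ca|exact: cg].
Qed.

Lemma scaled_jet (g : V -> R) (k g1 g2 : R) y i :
  jet2 (fun s => g (a + sg *: y + s *: delta_mx 0 i)) 0 g1 g2 ->
  jet2 (fun s => k * g (a + sg *: (y + s *: delta_mx 0 i))) 0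
    (k * sg * g1) (k * th * g2).
Proof.
move=> J.
have J1 : jet2 (fun s => sg * s) 0 sg 0.
  rewrite (_ : (fun s => sg * s) = fun s => sg * s + 0 * s ^+ 2).
    by apply: (jet2_eq (jet2_quadratic sg 0 0)); ring.
  by apply/funext => s; ring.
rewrite -(mulr0 sg) in J.
have J2 := jet2Z k (jet2_comp J1 J).
rewrite (_ : (fun s => k * g (a + sg *: (y + s *: delta_mx 0 i))) =
  fun s => k * g (a + sg *: y + (sg * s) *: delta_mx 0 i)).
  by apply: (jet2_eq J2); rewrite ?sg2; ring.
by apply/funext => s; rewrite scalerDr scalerA addrA.
Qed.

Lemma self_similar_ray y s t : 0 < t < T -> 0 < T + expR (- 2 * s) * (t - T) < T ->
  u (a + sg *: (expR s *: y)) t =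
  expR (- (2 * c) * s) * u (a + sg *: y) (T + expR (- 2 * s) * (t - T)).
Proof.
move=> tT lT; have l2 : expR (- s) ^+ 2 = expR (- 2 * s).
  by rewrite -expRM_natl; congr expR; ring.
rewrite (@u_ss _ _ _ (expR_gt0 (- s)) tT) ?l2//; congr (_ * u _ _).
  by rewrite -expRM; congr expR; rewrite mulrC; ring.
rewrite addrAC subrr add0r !scalerA; congr (_ + _ *: _).
by rewrite mulrAC -expRD addNr expR0 mul1r.
Qed.

Lemma self_similar_ray_t y s t : 0 < t < T -> 0 < T + expR (- 2 * s) * (t - T) < T ->
  ut (a + sg *: (expR s *: y)) t =
  expR (- (2 * c + 2) * s) * ut (a + sg *: y) (T + expR (- 2 * s) * (t - T)).
Proof.
move=> tT lT; set x := a + sg *: y.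
set l := expR (- 2 * s) in lT *.
have D1 : is_derive t 1 (fun t => T + l * (t + - T)) l.
  apply: (der_eq (derD (der_cst T t) (derZ l (derD (der_id t) (der_cst (- T) t))))).
  ring.
have D2 := derZ (expR (- (2 * c) * s)) (@derC _ _ (fun t => T + l * (t + - T)) _ _ _ (u_t x lT) D1).
have nt : \forall t' \near t, expR (- (2 * c) * s) * u x (T + l * (t' + - T)) =
    u (a + sg *: (expR s *: y)) t'.
  have n1 : \forall t' \near t, 0 < t' < T.
    by have := @near_in_itvoo R 0 T t; apply; rewrite in_itv.
  have n2 : \forall t' \near t, 0 < T + l * (t' - T) < T.
    have := der_cont D1; move/(_ _ (@near_in_itvoo R 0 T _ _)); apply.
    by rewrite in_itv.
  near=> t'; rewrite self_similar_ray//; first by near: t'.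
  by near: t'.
have := der_uniq (u_t _ tT) (der_near nt D2) => ->.
have -> : - (2 * c + 2) * s = - (2 * c) * s + - 2 * s by ring.
by rewrite expRD -/l; ring.
Unshelve. all: by end_near. Qed.

Lemma ray_der (g : R -> R) (g' k : R) : is_derive th 1 g g' ->
  is_derive (0 : R) 1 (fun s => expR (- k * s) * g (T + expR (- 2 * s) * (th - T)))
    (- k * g th + T * g').
Proof.
move=> Dg.
have De (m : R) : is_derive (0 : R) 1 (fun s => expR (m * s)) m.
  apply: (der_eq (derC (is_derive_expR _) (derZ m (der_id 0)))).
  by rewrite mulr0 expR0; ring.
have Dq : is_derive (0 : R) 1 (fun s => T + (th - T) * expR (- 2 * s)) T.
  by apply: (der_eq (derD (der_cst T 0) (derZ (th - T) (De (- 2))))); field.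
have q0 : T + (th - T) * expR (- 2 * 0) = th by rewrite mulr0 expR0; ring.
rewrite -q0 in Dg.
have := derM (De (- k)) (@derC _ _ (fun s => T + (th - T) * expR (- 2 * s)) _ _ _ Dg Dq).
under eq_fun do rewrite [(th - T) * _]mulrC.
move=> D; apply: (der_eq D); rewrite !mulr0 expR0; rewrite mulr0 expR0 in q0.
by rewrite -[in RHS]q0; ring.
Qed.

Lemma near_half_time :
  \forall s \near (0 : R), 0 < T + expR (- 2 * s) * (th - T) < T.
Proof.
have D : is_derive (0 : R) 1 (fun s => T + expR (- 2 * s) * (th - T))
    (0 + ((th - T) * (expR (- 2 * 0) * (- 2 * 1)))).
  have := derD (der_cst T 0)
    (derZ (th - T) (derC (is_derive_expR (- 2 * 0)) (derZ (- 2) (der_id 0)))).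
  by under eq_fun do rewrite [(th - T) * _]mulrC.
have := der_cont D; move/(_ _ (@near_in_itvoo R 0 T _ _)); apply.
by rewrite in_itv/= mulr0 expR0 mul1r addrC subrK half_time.
Qed.

(** The radial derivative of the speed, as differentiating the self-similarity
    relation for the time derivative in the scaling parameter gives it. *)
Definition speed_radial y : R :=
  2 * (K * th * th * utt (a + sg *: y) th) - 2 * (c + 1) * H y.

Lemma profile_jet y : ou_jet w y (fun i => K * sg * ui i (a + sg *: y) th)
  (fun i => K * th * uii i (a + sg *: y) th) (2 * H y - 2 * c * w y).
Proof.
split=> [i|]; first exact: (@scaled_jet (u ^~ th) _ _ _ _ _ (u_jet _ _ half_time)).
have D := derZ K (ray_der (2 * c) (u_t (a + sg *: y) half_time)).
apply: (@der_near _ _ _ _ _ _ (der_eq D _)).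
  have := near_half_time; apply: filterS => s /(self_similar_ray y half_time) E.
  by rewrite /profile E.
by rewrite /profile /speed; move: (K) (c) (u _ _) (ut _ _) => *; field.
Qed.

Lemma speed_jet y : ou_jet H y (fun i => K * th * sg * uti i (a + sg *: y) th)
  (fun i => K * th * th * utii i (a + sg *: y) th) (speed_radial y).
Proof.
split=> [i|]; first exact: (@scaled_jet (ut ^~ th) _ _ _ _ _ (ut_jet _ _ half_time)).
have D := derZ (K * th) (ray_der (2 * c + 2) (ut_t (a + sg *: y) half_time)).
apply: (@der_near _ _ _ _ _ _ (der_eq D _)).
  have := near_half_time; apply: filterS => s /(self_similar_ray_t y half_time) E.
  by rewrite /speed E.
by rewrite /speed_radial /speed; move: (K) (c) (utt _ _) (ut _ _) => *; field.
Qed.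

(** The speed is, up to a positive factor, the time derivative of the
    extension at time 0. *)
Lemma speed_gt0 y : 0 < H y.
Proof.
have T0 := T_gt0; set x := a + sg *: y.
have D : is_derive (0 : R) 1 (fun t => T `^ (- c) * K * u x (th + 2^-1 * t))
    (T `^ (- c) * K * (ut x th * 2^-1)).
  have D1 : is_derive (0 : R) 1 (fun t => th + 2^-1 * t) 2^-1.
    by apply: (der_eq (derD (der_cst th 0) (derZ 2^-1 (der_id 0)))); ring.
  have D2 := u_t x half_time.
  rewrite -[X in is_derive X](_ : th + 2^-1 * 0 = th) in D2; last by ring.
  exact: (derZ _ (@derC _ _ (fun t => th + 2^-1 * t) _ _ _ D2 D1)).
have nt : \forall t \near (0 : R), T `^ (- c) * K * u x (th + 2^-1 * t) =
    selfsim_ext p T a u (a + Num.sqrt T *: y) t.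
  have n1 : \forall t \near (0 : R), - T < t < T.
    by have := @near_in_itvoo R (- T) T 0; apply; rewrite in_itv/=; lra.
  apply: filterS n1 => t tT.
  have Tt : 0 < T - t by lra.
  pose s := - (2^-1 * ln ((T - t) / T)).
  have q0 : 0 < (T - t) / T by rewrite divr_gt0.
  have s2 : expR (- 2 * s) = (T - t) / T.
    by rewrite -[RHS]lnK ?posrE//; congr expR; rewrite /s; field.
  have time : T + expR (- 2 * s) * (th - T) = th + 2^-1 * t.
    by rewrite s2; field; rewrite gt_eqF.
  rewrite /selfsim_ext /profile addrAC subrr add0r [(Num.sqrt (T - t))^-1 *: _]scalerA.
  have -> : (Num.sqrt (T - t))^-1 * Num.sqrt T = expR s.
    rewrite -!powR12_sqrt ?(ltW T0) ?(ltW Tt)// /powR !gt_eqF// -expRN -expRD.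
    by congr expR; rewrite /s ln_div ?posrE//; field.
  rewrite self_similar_ray ?half_time// time; last lra.
  have -> : T `^ (- c) = (T - t) `^ (- c) * expR (- (2 * c) * s); last by ring.
  rewrite /powR !gt_eqF// -expRD; congr expR; rewrite /s ln_div ?posrE//; field.
  by have := p_gt1; lra.
have := u_mono (a + Num.sqrt T *: y); rewrite derive1E.
have [_ ->] := der_near nt D.
have P : 0 < T `^ (- c) * K by apply: mulr_gt0; [exact: powR_gt0|exact: K_gt0].
have P2 : 0 < 2^-1 :> R by rewrite invr_gt0.
rewrite (pmulr_rgt0 _ P) (pmulr_lgt0 _ P2) => ut0.
apply: mulr_gt0 => //; apply: mulr_gt0; [exact: K_gt0|lra].
Qed.

(** r^(2 c) w(r y) increases with r, at a rate given by the speed, and w(0) is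
    proportional to the speed at 0. *)
Lemma profile_gt0 y : 0 < w y.
Proof.
have c0 : 0 < c := exponent_gt0 p_gt1.
have w00 : 0 < w 0.
  have [_ D] := profile_jet 0.
  have E : (fun s : R => w (expR s *: 0)) = fun=> w 0.
    by apply/funext => s; rewrite scaler0.
  rewrite E in D; have := der_uniq D (der_cst _ _).
  have := speed_gt0 0; move=> H0 E0; have : 0 < c * w 0 by lra.
  by rewrite pmulr_rgt0.
pose g s := expR (2 * c * s) * w (expR s *: y).
pose g' s := 2 * expR (2 * c * s) * H (expR s *: y).
have dg s : is_derive s 1 g (g' s).
  have D := ou_jet_ray (profile_jet (expR s *: y)).
  have De := derC (is_derive_expR (2 * c * s)) (derZ (2 * c) (der_id s)).
  by apply: (der_eq (derM De D)); rewrite /g'; move: (c) => *; ring.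
have [s s0 ws] : exists2 s, s < 0 & 0 < w (expR s *: y).
  have cw : continuous w by exact: (@scaled_continuous (u ^~ th) K u_cont).
  have c1 : continuous (fun r : R => w (r *: y)).
    move=> r; apply: (@continuous_comp _ _ _ (fun r : R => r *: y) w).
      exact: scalel_continuous.
    exact: cw.
  have : \forall r \near (0 : R), 0 < w (r *: y).
    by apply: (c1 0 [set t | 0 < t]); apply: lt_nbhsr; rewrite scale0r.
  move=> /nbhs_ballP[e /= e0 He].
  have [r r0 r1] := small_step ltr01 e0.
  exists (ln r); first by rewrite ln_lt0// r0 r1.1.
  rewrite lnK ?posrE//; apply: He.
  by rewrite /ball/= sub0r normrN gtr0_norm// r1.2.
have [t _ E] := der_MVT dg s0.
have gs : 0 < g s by rewrite /g mulr_gt0 ?expR_gt0.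
have : 0 < g 0 - g s.
  rewrite E mulr_gt0//; last by rewrite subr_gt0.
  by rewrite /g' mulr_gt0 ?speed_gt0 ?mulr_gt0 ?expR_gt0.
rewrite {1}/g mulr0 !expR0 scale1r mul1r; lra.
Qed.

Lemma self_similar_profile_constant y : w y = c `^ c.
Proof.
have T0 := T_gt0; have p1 := p_gt1.
have th0 : 0 < th by lra.
have KP : K `^ (p - 1) = th.
  by rewrite -powRrM mulVf ?powRr1 ?ltW// gt_eqF// subr_gt0.
have u_gt0 x : 0 < u (a + sg *: x) th.
  by have := profile_gt0 x; rewrite /profile pmulr_rgt0// K_gt0.
have wp x : w x `^ (p - 1) = th * u (a + sg *: x) th `^ (p - 1).
  by rewrite /profile powRM ?(ltW K_gt0) ?ltW// KP.
apply: (@profile_constant _ _ p w H speed_radial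
  (fun y i => K * sg * ui i (a + sg *: y) th) (fun y i => K * th * uii i (a + sg *: y) th)
  (fun y i => K * th * sg * uti i (a + sg *: y) th)
  (fun y i => K * th * th * utii i (a + sg *: y) th)).
- exact: p_gt1.
- exact: profile_gt0.
- exact: speed_gt0.
- exact: profile_jet.
- exact: speed_jet.
- move=> x; rewrite -mulr_sumr (powR_pred p profile_gt0) wp /speed u_eq ?half_time//.
  by rewrite gtr0_norm// /profile; ring.
- move=> x; rewrite wp /ou -mulr_sumr /speed_radial.
  by rewrite (ut_eq half_time (u_gt0 x)) /speed; move: (K) (c) => *; field.
- exact: (@scaled_continuous (u ^~ th) K u_cont).
- exact: (@scaled_continuous (ut ^~ th) (K * th) ut_cont).
- by move=> i; exact: (@scaled_continuous ((ui i) ^~ th) (K * sg) (@ui_cont i)).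
Qed.

End self_similar_profile.

(** * Derivatives of the solution in space and time *)

Section spacetime_calculus.
Context {R : realType} {n : nat}.
Local Notation V := 'rV[R]_n.
Local Notation X := (V * R)%type.
Context (T : R).
Implicit Types (g : X -> R) (x : V) (t : R) (i : 'I_n).

Definition time_dir : X := (0, 1).
Definition space_dir i : X := (delta_mx 0 i, 0).

Lemma open_spacetime : open (@spacetime R n T).
Proof.
have -> : @spacetime R n T = snd @^-1` [set t | t \in `]0, T[%R].
  by apply/seteqP; split=> z; rewrite /spacetime/= in_itv.
apply: open_comp; last exact: interval_open.
by move=> z _; exact: cvg_snd.
Qed.

Lemma slice_jet g x t i : smooth_on (spacetime T) g -> 0 < t < T ->
  jet2 (fun s => g (x + s *: delta_mx 0 i, t)) 0
    ('D_(space_dir i) g (x, t)) ('D_(space_dir i) ('D_(space_dir i) g) (x, t)).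
Proof.
move=> gs tT; have := @smooth_jet2 _ _ _ g (x, t) (space_dir i) open_spacetime gs tT.
congr jet2; apply/funext => s; congr g.
by congr pair; rewrite /= /GRing.scale/= mulr0 addr0.
Qed.

Lemma slice_der g x t : smooth_on (spacetime T) g -> 0 < t < T ->
  is_derive t 1 (fun s => g (x, s)) ('D_time_dir g (x, t)).
Proof.
move=> gs tT.
have E s : (x, 0) + s *: time_dir = (x, s) :> X.
  by congr pair; rewrite /= ?scaler0 ?addr0// /GRing.scale/= mulr1 add0r.
rewrite (_ : (fun s => g (x, s)) = fun s => g ((x, 0) + s *: time_dir)).
  by have := @smooth_line_der _ _ _ g (x, 0) time_dir t gs; rewrite (E t) => /(_ tT).
by apply/funext => s; rewrite E.
Qed.

Lemma slice_continuous g t : smooth_on (spacetime T) g -> 0 < t < T ->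
  continuous (fun x : V => g (x, t)).
Proof.
move=> gs tT x; apply: (@continuous_comp _ _ _ (fun x : V => (x, t)) g).
  exact: (@cvg_pair _ _ _ _ (nbhs x) (nbhs t) _ _ _ id (fun=> t) cvg_id (cvg_cst t)).
exact: (smooth_cont gs).
Qed.

Lemma derive_slice g x t (v : V) :
  'D_v (fun y => g (y, t)) x = 'D_((v, 0) : X) g (x, t).
Proof.
have E : (fun h : R => h^-1 *: (g (h *: v + x, t) - g (x, t))) =
    fun h => h^-1 *: (g (h *: ((v, 0) : X) + (x, t)) - g (x, t)).
  apply/funext => h; congr (_ *: (g _ - _)).
  by congr pair; rewrite /= /GRing.scale/= mulr0 add0r.
by rewrite /derive/= E.
Qed.

Lemma laplacian_slice g x t : laplacian (fun y => g (y, t)) x =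
  \sum_(i < n) 'D_(space_dir i) ('D_(space_dir i) g) (x, t).
Proof.
apply: eq_bigr => i _.
have -> : (fun y => 'D_(delta_mx 0 i) (fun y => g (y, t)) y) =
    fun y => 'D_(space_dir i) g (y, t).
  by apply/funext => y; exact: derive_slice.
exact: (derive_slice ('D_(space_dir i) g)).
Qed.

End spacetime_calculus.

Section solution.
Context {R : realType} {n : nat}.
Local Notation V := 'rV[R]_n.
Local Notation X := (V * R)%type.
Context (p T : R) (u : V -> R -> R).
Context (sol : smooth_solution p T u).
Implicit Types (x : V) (t : R) (i : 'I_n).

Let f (z : X) := u z.1 z.2.

Lemma solution_eq x t : 0 < t < T -> 'D_time_dir f (x, t) =
  \sum_(i < n) 'D_(space_dir i) ('D_(space_dir i) f) (x, t) + `|u x t| `^ (p - 1) * u x t.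
Proof.
move=> tT; have [fs eq_u] := sol.
have [_ Et] := slice_der x fs tT; have := eq_u x t tT; rewrite derive1E => Eu.
apply: etrans (esym Et) _; apply: etrans Eu _.
by rewrite (laplacian_slice f).
Qed.

(** The equation differentiated in time; where u is positive the nonlinearity
    is the smooth function u^p. *)
Lemma solution_t_eq x t : 0 < t < T -> 0 < u x t -> 'D_time_dir ('D_time_dir f) (x, t) =
  \sum_(i < n) 'D_(space_dir i) ('D_(space_dir i) ('D_time_dir f)) (x, t)
  + p * u x t `^ (p - 1) * 'D_time_dir f (x, t).
Proof.
move=> tT u0; have [fs _] := sol; have oA := @open_spacetime R n T.
have Ax : spacetime T (x, t) by [].
rewrite (eq_bigr (fun i => 'D_time_dir ('D_(space_dir i) ('D_(space_dir i) f)) (x, t))); last first.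
  by move=> i _; exact: esym (derive_comm2 time_dir (space_dir i) oA fs Ax).
have D1 := slice_der x (smooth_derive time_dir fs) tT.
have Du : is_derive t 1 (u x) ('D_time_dir f (x, t)) := slice_der x fs tT.
have Ds i := slice_der x (smooth_derive (space_dir i) (smooth_derive (space_dir i) fs)) tT.
have D2 : is_derive t 1 (fun s => \sum_(i < n) 'D_(space_dir i) ('D_(space_dir i) f) (x, s))
    (\sum_(i < n) 'D_time_dir ('D_(space_dir i) ('D_(space_dir i) f)) (x, t)).
  rewrite (_ : (fun s => _) = \sum_(i < n) fun s => 'D_(space_dir i) ('D_(space_dir i) f) (x, s)).
    exact: is_derive_sum Ds.
  by apply/funext => s; rewrite fct_sumE.
have D3 := derC (is_derive1_powR p u0) Du.
have nE : \forall s \near t,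
    \sum_(i < n) 'D_(space_dir i) ('D_(space_dir i) f) (x, s) + u x s `^ p = 'D_time_dir f (x, s).
  have n1 : \forall s \near t, 0 < s < T.
    by have := @near_in_itvoo R 0 T t; apply; rewrite in_itv.
  have n2 : \forall s \near t, 0 < u x s.
    by have := der_cont Du; move/(_ _ (lt_nbhsr u0)).
  near=> s.
  have us : 0 < u x s by near: s.
  rewrite solution_eq; last by near: s.
  rewrite gtr0_norm// -{3}(powRr1 (ltW us)) -powRD ?subrK//.
  by rewrite (gt_eqF us) implybT.
exact: der_uniq D1 (der_near nE (derD D2 D3)).
Unshelve. all: by end_near. Qed.

End solution.

(** * The theorem *)

Theorem theorem1p1 (R : realType) (n : nat) (p T : R) (a : 'rV[R]_n)
    (u : 'rV[R]_n -> R -> R) :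
  (1 <= n)%N -> 1 < p -> 0 < T ->
  smooth_solution p T u ->
  self_similar p T a u ->
  (forall x : 'rV[R]_n, 0 < derive1 (selfsim_ext p T a u x) 0) ->
  (forall t : R, 0 < t < T -> (weighted_integral p T a u t < +oo)%E) \/
  1 + Num.sqrt (4 / 3) < p ->
  forall (x : 'rV[R]_n) (t : R), 0 < t < T ->
    u x t = (1 / (p - 1)) `^ (1 / (p - 1)) * (T - t) `^ (- (1 / (p - 1))).
Proof.
move=> _ p1 T0 sol ss mono _ x t tT; have [fs _] := sol.
have hT := half_time T0.
pose f (z : 'rV[R]_n * R) := u z.1 z.2.
rewrite -(selfsim_extE ss x tT) /selfsim_ext !div1r mulrC; congr (_ * _).
apply: (@self_similar_profile_constant R n p T a u
  (fun x t => 'D_time_dir f (x, t)) (fun x t => 'D_time_dir ('D_time_dir f) (x, t))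
  (fun i x t => 'D_(space_dir i) f (x, t)) (fun i x t => 'D_(space_dir i) ('D_(space_dir i) f) (x, t))
  (fun i x t => 'D_(space_dir i) ('D_time_dir f) (x, t))
  (fun i x t => 'D_(space_dir i) ('D_(space_dir i) ('D_time_dir f)) (x, t)) p1 T0).
- by move=> i y s sT; exact: (@slice_jet R n T f).
- by move=> i y s sT; exact: (@slice_jet R n T ('D_time_dir f) _ _ _ (smooth_derive time_dir fs)).
- by move=> y s sT; exact: (@slice_der R n T f).
- by move=> y s sT; exact: (@slice_der R n T ('D_time_dir f) _ _ (smooth_derive time_dir fs)).
- by move=> y s sT; exact: (solution_eq sol y sT).
- by move=> y s sT; exact: (solution_t_eq sol sT).
- exact: (@slice_continuous R n T f).
- exact: (@slice_continuous R n T ('D_time_dir f) _ (smooth_derive time_dir fs)).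
- by move=> i; exact: (@slice_continuous R n T ('D_(space_dir i) f) _ (smooth_derive (space_dir i) fs)).
- exact: ss.
- exact: mono.
Qed.
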